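(* Let $\alpha\in[1,2]$, $\kappa_1,\kappa_2\in\mathbb{R}$, $\gamma>0$, $f(u)=\kappa_1u+\tfrac32\gamma u^2$, $N\in\mathbb{N}$, and let $u_0\in L^2_{\mathrm{per}}(I)$ be real-valued. Then the semi-discrete Fourier spectral Galerkin scheme, which seeks $u_N(\cdot,t)\in V_N$ with $u_N(\cdot,0)=P_Nu_0$ and $$\bigl((u_N)_t,\phi\bigr)+\bigl((u_N)_t,\mathcal{D}^\alpha\phi\bigr)=\bigl(f(u_N),\phi_x\bigr)-\kappa_2\Bigl[2\bigl(u_N(u_N)_x,\mathcal{D}^\alpha\phi\bigr)+\bigl(u_N\mathcal{D}^\alpha(u_N)_x,\phi\bigr)\Bigr]\qquad\text{for all }\phi\in V_N,$$ admits a unique solution $u_N$ defined for all $t\in[0,\infty)$.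
   Context: $I=[-\pi,\pi]$; functions are $2\pi$-periodic in $x$. $L^2_{\mathrm{per}}(I)$ is the space of square-integrable periodic functions with inner product $(u,v)=\int_{-\pi}^{\pi}u\overline v\,dx$. Fourier coefficients: $\hat u(k)=\frac1{2\pi}\int_I u(x)e^{-ikx}\,dx$, $k\in\mathbb{Z}$. The fractional Laplacian $\mathcal{D}^\alpha=(-\Delta)^{\alpha/2}$ is the Fourier multiplier $\widehat{\mathcal{D}^\alpha u}(k)=|k|^\alpha\hat u(k)$. $V_N=\operatorname{span}\{e^{ikx}:-N\le k\le N\}$ (complex span), and $P_N$ is the $L^2$-orthogonal projection onto $V_N$, $P_N\xi=\sum_{|k|\le N}\hat\xi(k)e^{ikx}$. A solution means that $t\mapsto u_N(\cdot,t)\in V_N$ is continuously differentiable and satisfies the displayed identity for all $t$ (an ODE system for the Fourier coefficients of $u_N$). *)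

(* Defs.v *)
From HB Require Import structures.
From mathcomp Require Import all_boot all_order all_algebra.
From mathcomp Require Import all_classical all_reals all_analysis.
From mathcomp Require Import complex.

Set Implicit Arguments.
Unset Strict Implicit.
Unset Printing Implicit Defensive.

Import Order.TTheory GRing.Theory Num.Theory.
Import numFieldNormedType.Exports.

Local Open Scope classical_set_scope.
Local Open Scope complex_scope.
Local Open Scope ring_scope.

Section Defs.
Variable R : realType.

Local Notation C := R[i].
Local Notation Re := (@complex.Re R).
Local Notation Im := (@complex.Im R).
Local Notation mu := (@lebesgue_measure R).

Implicit Types (u v w phi : R -> C) (k : int) (N : nat).

Definition torus : set R := `[- pi, pi].

(* The library integrates real functions only, so the Lebesgue integral of a
   complex function is taken componentwise. *)
Definition Cintegral u : C :=
  (\int[mu]_(x in torus) Re (u x))%R +i* (\int[mu]_(x in torus) Im (u x))%R.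

Definition inner u v : C := Cintegral (fun x => u x * (v x)^*).

Definition L2norm u : R := Num.sqrt (Re (inner u u)).

(* Elements of L^2_per are represented by everywhere-defined periodic
   functions. *)
Definition L2per u : Prop :=
  [/\ forall x, u (x + 2 * pi) = u x,
      measurable_fun torus (fun x => Re (u x)),
      measurable_fun torus (fun x => Im (u x)) &
      mu.-integrable torus (fun x => ((Re (u x)) ^+ 2 + (Im (u x)) ^+ 2)%:E)].

Definition expi k (x : R) : C := cos (k%:~R * x) +i* sin (k%:~R * x).

Definition fourier u k : C :=
  ((2 * pi)^-1)%:C * Cintegral (fun x => u x * expi (- k) x).

Definition modes N : set int := [set k | `|k| <= N%:Z].

Definition VN N u : Prop :=
  exists c : int -> C, forall x, u x = \sum_(k \in modes N) c k * expi k x.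

Definition PN N u (x : R) : C :=
  \sum_(k \in modes N) fourier u k * expi k x.

(* The Fourier multiplier |k|^alpha.  [\sum_(k \in setT)] is the sum over the
   support of the summand when that support is finite and 0 otherwise, so this
   is the fractional Laplacian exactly on trigonometric polynomials, i.e. on
   the union of the V_N, which is the only place where it is used. *)
Definition fracLap (alpha : R) u (x : R) : C :=
  \sum_(k \in [set: int]) (`|k|%:~R `^ alpha)%:C * fourier u k * expi k x.

Definition dx u (x : R) : C :=
  derive1 (Re \o u) x +i* derive1 (Im \o u) x.

Definition nlflux (kappa1 gamma : R) (z : C) : C :=
  kappa1%:C * z + (3 / 2 * gamma)%:C * z ^+ 2.

(* [U] is differentiable on [0, +oo[ (from the right at 0) with derivative
   [U'], both for the L^2 norm; [U'] is moreover continuous on [0, +oo[.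
   Values of [U] and [U'] at negative times are irrelevant. *)
Definition C1_with_derivative (U U' : R -> R -> C) : Prop :=
  forall t : R, 0 <= t ->
    (L2norm (fun x => ((s - t)^-1)%:C * (U s x - U t x) - U' t x)
       @[s --> within `[0, +oo[ t^'] --> (0 : R)) /\
    (L2norm (fun x => U' s x - U' t x)
       @[s --> within `[0, +oo[ (nbhs t)] --> (0 : R)).

Definition galerkin_identity (alpha kappa1 kappa2 gamma : R) w wt phi : Prop :=
  inner wt phi + inner wt (fracLap alpha phi) =
  inner (fun x => nlflux kappa1 gamma (w x)) (dx phi)
  - kappa2%:C *
    (2 * inner (fun x => w x * dx w x) (fracLap alpha phi)
     + inner (fun x => w x * fracLap alpha (dx w) x) phi).

Definition galerkin_solution (alpha kappa1 kappa2 gamma : R) N u0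
    (U : R -> R -> C) : Prop :=
  [/\ forall t : R, 0 <= t -> VN N (U t),
      forall x, U 0 x = PN N u0 x &
      exists U' : R -> R -> C,
        [/\ forall t : R, 0 <= t -> VN N (U' t),
            C1_with_derivative U U' &
            forall (t : R) phi, 0 <= t -> VN N phi ->
              galerkin_identity alpha kappa1 kappa2 gamma (U t) (U' t) phi]].

End Defs.

(* Main.v *)
(* Writing u_N = sum_j c_j(t) e^{ijx}, the scheme is the polynomial system
   (1 + |j|^alpha) c_j' = R_j(c), whose right-hand side is locally Lipschitz; this gives
   uniqueness.  For global existence, pair R(c) with u_N itself: with the symmetric trilinear
   form T(a, b, d) = sum_{p+q+r=0} a_p b_q d_r, i.e. the mean of a product of three functions,
   integration by parts shows sum_j R_j(c) c_{-j} = 0, the two kappa_2 terms cancelling each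
   other.  As real initial data keep c_{-j} equal to the conjugate of c_j, the energy
   sum_j (1 + |j|^alpha) |c_j|^2 is conserved.  A system with a conserved weighted l^2 norm has
   global solutions: cut the vector field off outside a large ball, solve the resulting globally
   Lipschitz system by Picard iteration, and note that energy conservation keeps the solution
   where the cutoff is inactive. *)

Require Import Defs.
From HB Require Import structures.
From mathcomp Require Import all_boot all_order all_algebra.
From mathcomp Require Import all_classical all_reals all_analysis.
From mathcomp Require Import complex zify ring lra.

Set Implicit Arguments.
Unset Strict Implicit.
Unset Printing Implicit Defensive.

Import Order.TTheory GRing.Theory Num.Theory.
Import numFieldNormedType.Exports.

Local Open Scope classical_set_scope.
Local Open Scope complex_scope.
Local Open Scope ring_scope.

(** * Global solutions of ordinary differential equations *)

Section Antiderivative.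
Variable R : realType.
Implicit Types (f g : R -> R) (t K l : R).

(** The energy identity is bilinear: it pairs [c] with its reversal, not with its conjugate, and so
    bounds nothing unless [c] is Hermitian. The abstract existence theorem, however, asks for an
    orthogonality relation at every point of a real vector space, because the cut-off system is
    solved before anything is known about symmetry. The vector field is therefore precomposed with
    the Hermitian projection: its values are then Hermitian, the relation holds at all points, and
    the Hermitian part of the solution solves the original system. A second obstacle is the endpoint
    0, where a Galerkin solution has only a one-sided derivative while [is_derive] is two-sided. The
    constructed solution is arranged to be differentiable from both sides at 0; arbitrary ones enter
    only through continuity on the half line and derivatives at positive times. Competing solutions
    are not known to be real either, so uniqueness rests on compactness of bounded time intervals
    and not on the energy. *)

Lemma is_derive_bigsum (I : Type) (r : seq I) (f : I -> R -> R) (d : I -> R) t :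
  (forall i, is_derive t 1 (f i) (d i)) ->
  is_derive t 1 (fun s => \sum_(i <- r) f i s) (\sum_(i <- r) d i).
Proof.
move=> fd; elim: r => [|i r IH].
  rewrite big_nil; have -> : (fun s => \sum_(i <- [::]) f i s) = cst 0.
    by apply/funext => s; rewrite big_nil.
  exact: is_derive_cst.
rewrite big_cons.
have -> : (fun s => \sum_(j <- i :: r) f j s) = f i + (fun s => \sum_(j <- r) f j s).
  by apply/funext => s; rewrite big_cons.
exact: is_deriveD.
Qed.

Lemma ge0_derive_le f (df : R -> R) t : 0 <= t ->
  (forall s : R, 0 <= s -> is_derive s 1 f (df s)) ->
  (forall s : R, 0 <= s -> 0 <= df s) -> f 0 <= f t.
Proof.
move=> t0 fd d0; apply: (@ger0_derive1_ndecry _ f 0) => //.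
- by move=> x; rewrite in_itv/= andbT => x0; have [] := fd x (ltW x0).
- move=> x; rewrite in_itv/= andbT => x0; rewrite derive1E.
  by have [_ ->] := fd x (ltW x0); apply: d0; exact: ltW.
- apply: derivable_within_continuous => x; rewrite in_itv/= andbT => x0.
  by have [] := fd x x0.
Qed.

Lemma antiderivative g : continuous g ->
  exists h, h 0 = 0 /\ forall t : R, 0 <= t -> is_derive t 1 h (g t).
Proof.
move=> cg.
(* The base point -1 makes every [t >= 0] an interior point, so that the derivative is two-sided
   even at 0. *)
pose F x : R := (\int[@lebesgue_measure R]_(t in [set` `[-1, x]]) g t)%R.
exists (fun x => F x - F 0); split; first by rewrite subrr.
move=> t t0.
have ig : (@lebesgue_measure R).-integrable `[-1, t + 1] (EFin \o g).
  apply: (@continuous_compact_integrable R g); first exact: segment_compact.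
  exact: continuous_subspaceT.
have [|||dF dFE] := @continuous_FTC1_closed R g (-1) t (t + 1) _ ig.
- by rewrite ltrDl.
- by rewrite (lt_le_trans _ t0)// ltrN10.
- exact: cg.
have FD : is_derive t 1 F (g t).
  by apply: (DeriveDef dF); rewrite -derive1E; exact: dFE.
have -> : (fun x => F x - F 0) = F - cst (F 0) by [].
by apply: is_derive_eq; rewrite subr0.
Qed.

(** Left unspecified at negative times; the Picard iterates therefore evaluate it at
    [Num.max t 0]. *)
Definition primitive g : R -> R :=
  xget (cst 0) [set h : R -> R | h 0 = 0 /\
    forall t : R, 0 <= t -> is_derive t 1 h (g t)].

Lemma primitiveP g : continuous g -> primitive g 0 = 0 /\
  forall t : R, 0 <= t -> is_derive t 1 (primitive g) (g t).
Proof.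
by move=> /antiderivative [h hP]; rewrite /primitive; case: xgetP => [_ -> //|/(_ h)].
Qed.

Lemma is_derive_mulr (a t : R) : is_derive t 1 ( *%R a) a.
Proof.
have -> : *%R a = a \*: (@id R) by apply/funext.
by apply: is_derive_eq; rewrite /GRing.scale/= mulr1.
Qed.

Lemma is_derive_expRM l t :
  is_derive t 1 (fun s => expR (l * s)) (l * expR (l * t)).
Proof.
rewrite mulrC.
exact: (@is_derive1_comp R expR ( *%R l) t _ _ (is_derive_expR _) (is_derive_mulr _ _)).
Qed.

(** Integration divides the exponential weight by [l], which is the source of the contraction. The
    function [K / l * expR (l * s)] minus the difference of the primitives is nondecreasing and
    starts at [K / l >= 0]. *)
Lemma primitive_sub_le g1 g2 K l t : continuous g1 -> continuous g2 -> 0 < l -> 0 <= K ->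
  (forall s : R, 0 <= s -> `|g1 s - g2 s| <= K * expR (l * s)) -> 0 <= t ->
  `|primitive g1 t - primitive g2 t| <= K / l * expR (l * t).
Proof.
have main h1 h2 : continuous h1 -> continuous h2 -> 0 < l -> 0 <= K ->
  (forall s : R, 0 <= s -> `|h1 s - h2 s| <= K * expR (l * s)) -> 0 <= t ->
  primitive h1 t - primitive h2 t <= K / l * expR (l * t).
  move=> /primitiveP[h10 h1d] /primitiveP[h20 h2d] l0 K0 hle t0.
  pose f := (K / l) \*: (fun s => expR (l * s)) - (primitive h1 - primitive h2).
  have : f 0 <= f t.
    apply: (@ge0_derive_le f
      (fun s => K / l * (l * expR (l * s)) - (h1 s - h2 s)) t t0) => s s0.
      have := h1d s s0; have := h2d s s0; have := is_derive_expRM l s => d0 d1 d2.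
      by apply: is_derive_eq.
    rewrite mulrA divfK ?gt_eqF// subr_ge0.
    exact: le_trans (ler_norm _) (hle s s0).
  rewrite /f !fctE/= h10 h20 !subr0 mulr0 expR0 /GRing.scale/= mulr1 => fle.
  rewrite -subr_ge0; apply: le_trans fle.
  by rewrite divr_ge0// ltW.
move=> c1 c2 l0 K0 g12 t0; rewrite ler_norml; apply/andP; split; last exact: main.
rewrite lerNl opprB; apply: main => // s s0.
by rewrite distrC; exact: g12.
Qed.

Lemma continuous_max0 : continuous (fun s : R => Num.max s 0).
Proof.
move=> s; apply: (@continuous_max R R id (cst 0)); first exact: cvg_id.
exact: cvg_cst.
Qed.

Lemma primitive_max0_continuous g : continuous g ->
  continuous (fun s : R => primitive g (Num.max s 0)).
Proof.
move=> /primitiveP[_ d] s.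
apply: (@continuous_comp _ _ _ (fun s : R => Num.max s 0) (primitive g)).
  exact: continuous_max0.
apply: differentiable_continuous; apply/derivable1_diffP.
by have [] := d (Num.max s 0) _; rewrite // le_max lexx orbT.
Qed.

End Antiderivative.

(** * Picard iteration for a globally Lipschitz field on the whole half line *)

Section GlobalLipschitz.
Variables (R : realType) (T : finType).
Implicit Types (x y : T -> R) (i j : T).

Definition dist1 x y : R := \sum_i `|x i - y i|.

Lemma dist1_ge0 x y : 0 <= dist1 x y.
Proof. exact: sumr_ge0. Qed.

Lemma le_dist1 x y i : `|x i - y i| <= dist1 x y.
Proof. by rewrite /dist1 (bigD1 i)//= lerDl sumr_ge0. Qed.

Lemma dist1_le_const x y (K : R) :
  (forall i, `|x i - y i| <= K) -> dist1 x y <= #|T|%:R * K.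
Proof.
move=> h; apply: (@le_trans _ _ (\sum_(i : T) K)); first exact: ler_sum.
by rewrite sumr_const mulr_natl.
Qed.

Lemma dist1_cvg0 (S : Type) (F : set_system S) (FF : Filter F) (u : T -> S -> R) y :
  (forall i, u i @ F --> y i) -> dist1 (u^~ s) y @[s --> F] --> (0 : R).
Proof.
move=> uy; have -> : 0 = \sum_(i : T) `|y i - y i| :> R.
  by rewrite big1// => i _; rewrite subrr normr0.
apply: cvg_big => [|i _].
  exact: add_continuous.
by apply: cvg_norm; apply: cvgB => //; exact: cvg_cst.
Qed.

Variables (G : T -> (T -> R) -> R) (L : R).
Hypothesis L0 : 0 <= L.
Hypothesis GL : forall i x y, `|G i x - G i y| <= L * dist1 x y.

Lemma lipschitz_cvg (F : set_system R) (FF : Filter F) i (u : T -> R -> R) (y : T -> R) :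
  (forall j, u j @ F --> y j) -> G i (u^~ s) @[s --> F] --> G i y.
Proof.
move=> /(dist1_cvg0 FF) uy; apply/cvgrPdist_lt => e e0.
have h : L * dist1 (u^~ s) y @[s --> F] --> (0 : R).
  by rewrite -[0](mulr0 L); apply: cvgM => //; exact: cvg_cst.
apply: filterS (cvgr0_norm_lt _ h _ e0) => s.
apply: le_lt_trans; rewrite distrC; apply: le_trans (GL _ _ _) _.
exact: ler_norm.
Qed.

Variable x0 : T -> R.

(** The Lipschitz bound costs a factor [L * #|T|] and integration gains [1 / l]: the 2 makes the
    ratio at most one half, the 1 keeps [l] positive when [L] vanishes. *)
Let l : R := 2 * (L * #|T|%:R + 1).

Let l0 : 0 < l.
Proof. by rewrite mulr_gt0// ltr_wpDl// mulr_ge0. Qed.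

Definition picard_step (u : T -> R -> R) i (t : R) : R :=
  x0 i + primitive (fun s => G i (u^~ s)) (Num.max t 0).

Definition picard n : T -> R -> R := iter n picard_step (fun i => cst (x0 i)).

Let GC (u : T -> R -> R) : (forall j, continuous (u j)) ->
  forall i, continuous (fun s => G i (u^~ s)).
Proof. by move=> uc i t; apply: lipschitz_cvg => j; exact: uc. Qed.

Let picard_step_continuous (u : T -> R -> R) : (forall j, continuous (u j)) ->
  forall i, continuous (picard_step u i).
Proof.
move=> uc i t; rewrite /picard_step; apply: cvgD; first exact: cvg_cst.
by apply: primitive_max0_continuous; exact: GC.
Qed.

Let picard_continuous n i : continuous (picard n i).
Proof.
elim: n i => [|n IH] i; first exact: cst_continuous.
exact: picard_step_continuous.
Qed.

(* In the norm weighted by this exponential the Picard operator contracts by [1 / 2] on the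
   whole half line.  Iterates are extended to negative times by their value at [0]. *)
Let e (t : R) : R := expR (l * Num.max t 0).

Let e_gt0 t : 0 < e t. Proof. exact: expR_gt0. Qed.

Let contract (u v : T -> R -> R) (K : R) : 0 <= K ->
  (forall j, continuous (u j)) -> (forall j, continuous (v j)) ->
  (forall j t, `|u j t - v j t| <= K * e t) ->
  forall i t, `|picard_step u i t - picard_step v i t| <= K / 2 * e t.
Proof.
move=> K0 uc vc uv i t; rewrite /picard_step opprD addrACA subrr add0r.
have -> : K / 2 = (L * #|T|%:R + 1) * K / l.
  by rewrite /l; field; rewrite gt_eqF//= ltr_wpDl// mulr_ge0.
apply: primitive_sub_le => //; try exact: GC.
- by rewrite mulr_ge0// addr_ge0// mulr_ge0.
- move=> s s0; apply: le_trans (GL _ _ _) _.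
  have es : e s = expR (l * s) by rewrite /e max_l.
  apply: (@le_trans _ _ (L * (#|T|%:R * (K * expR (l * s))))).
    apply: ler_wpM2l => //; apply: dist1_le_const => j.
    by rewrite -es; exact: uv.
  have := expR_gt0 (l * s); move: (expR _) => E E0.
  rewrite -subr_ge0 (_ : _ - _ = K * E); last by ring.
  by rewrite mulr_ge0// ltW.
- by rewrite le_max lexx orbT.
Qed.

Let halfS n : 2 ^- n.+1 = 2 ^- n / 2 :> R.
Proof. by rewrite exprS invfM mulrC. Qed.

Let halfD n k : 2 ^- (n + k) = 2 ^- n * 2 ^- k :> R.
Proof. by rewrite exprD invfM. Qed.

Let K1 : R := \sum_i `|G i x0|.

Let K1_ge0 : 0 <= K1. Proof. exact: sumr_ge0. Qed.

Let picard_succ n : forall i t,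
  `|picard n.+1 i t - picard n i t| <= (K1 / l) * 2 ^- n * e t.
Proof.
elim: n => [|n IH] i t.
  rewrite /= /picard_step /= expr0 invr1 mulr1.
  (* [primitive] is known only through its derivative and its value at 0, so its vanishing here is
     obtained from monotonicity in both directions. The first increment then becomes a difference of
     two primitives. *)
  have p0 : primitive (fun=> 0 : R) (Num.max t 0) = 0.
    have /primitiveP[h0 hd] := @cst_continuous R R (0 : R).
    have t0 : 0 <= Num.max t (0 : R) by rewrite le_max lexx orbT.
    apply/eqP; rewrite eq_le; apply/andP; split.
      have := @ge0_derive_le R (- primitive (cst 0)) (fun _ => 0) _ t0.
      rewrite !fctE h0 oppr0 oppr_ge0; apply => // s s0.
      by have := hd s s0 => d; apply: is_derive_eq; rewrite oppr0.
    have := @ge0_derive_le R (primitive (cst 0)) (fun _ => 0) _ t0.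
    by rewrite h0; apply.
  rewrite addrAC subrr add0r.
  rewrite -[primitive _ _]subr0 -[X in _ - X]p0.
  apply: primitive_sub_le => //.
  - exact: cst_continuous.
  - exact: cst_continuous.
  - move=> s s0; rewrite subr0.
    apply: (@le_trans _ _ K1).
      by rewrite /K1 (bigD1 i)//= lerDl sumr_ge0.
    rewrite ler_peMr// -[1]expR0 ler_expR mulr_ge0//.
    exact: ltW.
  - by rewrite le_max lexx orbT.
rewrite (_ : _ * _ = K1 / l * 2 ^- n / 2 * e t); last first.
  by rewrite halfS !mulrA.
apply: (contract (u := picard n.+1) (v := picard n)) => //.
by rewrite mulr_ge0// divr_ge0// ltW.
Qed.

Let K := 2 * (K1 / l).

Let K_ge0 : 0 <= K.
Proof. by rewrite mulr_ge0// divr_ge0// ltW. Qed.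

(** The factor [1 - 2 ^- k] is the partial sum of the geometric series of increments; keeping it
    turns the induction step into an equality. *)
Let picard_add n k i t :
  `|picard (n + k) i t - picard n i t| <= K * 2 ^- n * (1 - 2 ^- k) * e t.
Proof.
elim: k => [|k IH].
  by rewrite addn0 !subrr normr0 expr0 invr1 subrr mulr0 mul0r.
rewrite addnS.
have := le_trans (ler_distD (picard (n + k) i t) _ _) (lerD (picard_succ _ i t) IH).
move/le_trans; apply; rewrite le_eqVlt; apply/orP; left; apply/eqP.
rewrite /K halfS halfD; move: (2 ^- k) (2 ^- n) (K1 / l) (e t) => a b c d.
by field.
Qed.

Let picard_dist n m i t : (n <= m)%N ->
  `|picard m i t - picard n i t| <= K * 2 ^- n * e t.
Proof.
move=> /subnKC <-; apply: le_trans (picard_add _ _ _ _) _.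
apply: ler_wpM2r; first exact: ltW.
rewrite -[leRHS]mulr1; apply: ler_wpM2l.
  by rewrite mulr_ge0// invr_ge0 exprn_ge0.
by rewrite gerBl invr_ge0 exprn_ge0.
Qed.

Lemma cvg_half_pow (C : R) : C * 2 ^- n @[n --> \oo] --> (0 : R).
Proof.
have := @cvg_geometric R C 2^-1; rewrite ger0_norm// invf_lt1// ltr1n => /(_ isT).
suff -> : geometric C 2^-1 = fun n => C * 2 ^- n by [].
by apply/funext => n; rewrite /geometric/= exprVn.
Qed.

Let picard_cvg i t : cvg (picard n i t @[n --> \oo]).
Proof.
apply: cauchy_cvg; apply: cauchy_exP => _/posnumP[d].
have : \forall n \near \oo, `|K * e t * 2 ^- n| < d%:num.
  by apply: cvgr0_norm_lt => //; exact: cvg_half_pow.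
case=> n _ nd; exists (picard n i t); exists n => // m /= nm.
rewrite -ball_normE/= distrC; apply: le_lt_trans (picard_dist i t nm) _.
by have := nd n (leqnn _); rewrite mulrAC; apply: le_lt_trans; exact: ler_norm.
Qed.

Let u i (t : R) : R := lim (picard n i t @[n --> \oo]).

Let u_dist n i t : `|u i t - picard n i t| <= K * 2 ^- n * e t.
Proof.
have h : `|picard m i t - picard n i t| @[m --> \oo] --> `|u i t - picard n i t|.
  by apply: cvg_norm; apply: cvgB; [exact: picard_cvg|exact: cvg_cst].
apply: (@closed_cvg _ _ \oo _ _ [set y | y <= K * 2 ^- n * e t] _ _ _ h).
  exact: closed_le.
by exists n => // m /= nm; exact: picard_dist.
Qed.

Let u_continuous i : continuous (u i).
Proof.
move=> t; apply/cvgrPdist_lt => d d0.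
have d3 : 0 < d / 3 by rewrite divr_gt0.
(* The weight [e] is nondecreasing, so its value at [t + 1] controls the error uniformly on a
   neighbourhood of [t], as the three-epsilon argument requires. *)
have : \forall n \near \oo, `|K * e (t + 1) * 2 ^- n| < d / 3.
  by apply: cvgr0_norm_lt => //; exact: cvg_half_pow.
case=> n _ /(_ n (leqnn _)) nd.
have {}nd s : s <= t + 1 -> `|u i s - picard n i s| < d / 3.
  move=> st; apply: le_lt_trans (u_dist n i s) _.
  apply: le_lt_trans (le_lt_trans (ler_norm _) nd).
  rewrite [leRHS]mulrAC; apply: ler_wpM2l.
    by rewrite mulr_ge0// invr_ge0 exprn_ge0.
  rewrite /e ler_expR; apply: ler_wpM2l; first exact: ltW.
  by rewrite ge_max le_max st/= le_max lexx orbT.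
near=> s.
have -> : u i t - u i s = (u i t - picard n i t) + (picard n i t - picard n i s)
   - (u i s - picard n i s) by ring.
have -> : d = d / 3 + d / 3 + d / 3 by field.
apply: le_lt_trans (ler_normB _ _) _; apply: ltrD; last first.
  by apply: nd; apply: ltW; near: s; apply: lt_nbhsl; rewrite ltrDl.
apply: le_lt_trans (ler_normD _ _) _; apply: ltrD.
  by apply: nd; rewrite lerDl.
by near: s; have /cvgrPdist_lt := @picard_continuous n i t; exact.
Unshelve. all: by end_near. Qed.

Let u_fix i t : u i t = picard_step u i t.
Proof.
apply/eqP; rewrite -subr_eq0 -normr_le0.
have h := cvg_half_pow (K * e t).
apply: (@closed_cvg _ _ \oo _ _ [set y | `|u i t - picard_step u i t| <= y] _ _ _ h).
  exact: closed_ge.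
exists 0 => // n _ /=.
(* [picard n.+1] is one step applied to [picard n]: the error of the limit plus one contraction is a
   bound that vanishes with [n]. *)
have -> : u i t - picard_step u i t = (u i t - picard n.+1 i t)
   - (picard_step u i t - picard n.+1 i t) by ring.
apply: le_trans (ler_normB _ _) _.
have -> : K * e t * 2 ^- n = K * 2 ^- n.+1 * e t + K * 2 ^- n / 2 * e t.
  by rewrite halfS; move: (2 ^- n) (e t) => a b; field.
apply: lerD; first exact: u_dist.
apply: contract => //. by rewrite mulr_ge0// invr_ge0 exprn_ge0.
Qed.

Lemma lipschitz_solution : exists w : T -> R -> R, (forall i, w i 0 = x0 i) /\
  forall i (t : R), 0 <= t -> is_derive t 1 (w i) (G i (w^~ t)).
Proof.
pose g i (s : R) := G i (u^~ s).
(* The limit [u] is constant at negative times and may fail to have a two-sided derivative at 0.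
   This function has one, and agrees with [u] at nonnegative times. *)
exists (fun i s => x0 i + primitive (g i) s); split.
  by move=> i; have [-> _] := primitiveP (@GC u u_continuous i); rewrite addr0.
move=> i t t0; have [_ d] := primitiveP (@GC u u_continuous i).
have -> : (fun s => x0 i + primitive (g i) s) = cst (x0 i) + primitive (g i) by [].
have := d t t0 => {}d; apply: is_derive_eq; rewrite add0r; congr (G i _).
by apply/funext => j; rewrite u_fix /picard_step max_l.
Qed.

End GlobalLipschitz.

(** * Locally Lipschitz functions of finitely many real variables *)

Section LocallyLipschitz.
Variables (R : realType) (T : finType).
Implicit Types (x y : T -> R) (f g : (T -> R) -> R) (i j : T) (M L : R).

Definition loclip f := forall M, exists2 L, 0 <= L & forall x y,
  (forall i, `|x i| <= M) -> (forall i, `|y i| <= M) ->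
  `|f x - f y| <= L * dist1 x y.

Lemma loclip_bounded f M : loclip f ->
  exists2 B, 0 <= B & forall x, (forall i, `|x i| <= M) -> `|f x| <= B.
Proof.
(* The absolute value keeps the origin, used as comparison point, in the ball when [M] is
   negative. *)
move=> /(_ `|M|)[L L0 fL].
exists (`|f (fun=> 0)| + L * (#|T|%:R * `|M|)); first by rewrite addr_ge0// !mulr_ge0.
move=> x xM; rewrite -[f x](subrK (f (fun=> 0))) addrC.
have xM' i : `|x i| <= `|M| by apply: le_trans (xM i) (ler_norm _).
apply: le_trans (ler_normD _ _) _; rewrite lerD2l.
apply: le_trans (fL _ _ xM' _) _; first by move=> i; rewrite normr0.
by apply: ler_wpM2l => //; apply: dist1_le_const => i; rewrite subr0.
Qed.

Lemma loclip_cst (c : R) : loclip (fun=> c).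
Proof. by move=> M; exists 0 => // x y _ _; rewrite subrr normr0 mul0r. Qed.

Lemma loclip_coord i : loclip (fun x => x i).
Proof. by move=> M; exists 1 => // x y _ _; rewrite mul1r le_dist1. Qed.

Lemma loclipD f g : loclip f -> loclip g -> loclip (fun x => f x + g x).
Proof.
move=> fl gl M; have [L L0 fL] := fl M; have [L' L'0 gL] := gl M.
exists (L + L'); first exact: addr_ge0.
move=> x y xM yM; rewrite opprD addrACA mulrDl.
by apply: le_trans (ler_normD _ _) _; apply: lerD; [exact: fL|exact: gL].
Qed.

Lemma loclipM f g : loclip f -> loclip g -> loclip (fun x => f x * g x).
Proof.
move=> fl gl M; have [L L0 fL] := fl M; have [L' L'0 gL] := gl M.
have [B B0 fB] := loclip_bounded M fl; have [B' B'0 gB] := loclip_bounded M gl.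
exists (B * L' + L * B'); first by rewrite addr_ge0// mulr_ge0.
move=> x y xM yM.
have -> : f x * g x - f y * g y = f x * (g x - g y) + (f x - f y) * g y by ring.
apply: le_trans (ler_normD _ _) _; rewrite !normrM mulrDl; apply: lerD.
  by rewrite -mulrA ler_pM//; [exact: fB|exact: gL].
by rewrite mulrAC ler_pM//; [exact: fL|exact: gB].
Qed.

Lemma loclipN f : loclip f -> loclip (fun x => - f x).
Proof.
move=> fl M; have [L L0 fL] := fl M; exists L => // x y xM yM.
by rewrite -opprD normrN; exact: fL.
Qed.

Lemma loclip_sum (I : Type) (r : seq I) (h : I -> (T -> R) -> R) :
  (forall k, loclip (h k)) -> loclip (fun x => \sum_(k <- r) h k x).
Proof.
move=> hl; elim: r => [|k r IH].
  by move=> M; exists 0 => // x y _ _; rewrite !big_nil subrr normr0 mul0r.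
move=> M; have [L L0 hL] := loclipD (hl k) IH M.
by exists L => // x y xM yM; rewrite !big_cons; exact: hL.
Qed.

Lemma loclip_continuous (S : Type) (F : set_system S) (FF : Filter F) f
    (u : T -> S -> R) (y : T -> R) :
  loclip f -> (forall j, u j @ F --> y j) -> f (u^~ s) @[s --> F] --> f y.
Proof.
move=> fl uy; pose M := \sum_i `|y i| + 1.
have [L L0 fL] := fl M; apply/cvgrPdist_lt => e e0.
have yM i : `|y i| <= M - 1 by rewrite /M addrK (bigD1 i)//= lerDl sumr_ge0.
have h : L * dist1 (u^~ s) y @[s --> F] --> (0 : R).
  rewrite -[0](mulr0 L); apply: cvgM; first exact: cvg_cst.
  exact: dist1_cvg0.
have near1 : \forall s \near F, forall i, `|y i - u i s| < 1.
  apply: filter_forall => i.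
  by have /cvgrPdist_lt := uy i; apply.
apply: filterS2 near1 (cvgr0_norm_lt _ h _ e0) => s uM.
apply: le_lt_trans; rewrite distrC.
apply: le_trans (fL _ _ _ _) (ler_norm _) => i.
  rewrite -[u i s](subrK (y i)); apply: le_trans (ler_normD _ _) _.
  by rewrite -[M](subrK 1) addrC lerD// distrC ltW// uM.
by apply: le_trans (yM i) _; rewrite gerBl.
Qed.

(** * Truncation of a locally Lipschitz field, global existence and uniqueness *)

Definition clamp (lo hi c : R) : R := Num.max lo (Num.min c hi).

Lemma clamp_bounds lo hi c : lo <= hi -> lo <= clamp lo hi c <= hi.
Proof. by move=> h; rewrite /clamp le_max lexx/= ge_max h ge_min lexx orbT. Qed.

Lemma clamp_id lo hi c : lo <= c <= hi -> clamp lo hi c = c.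
Proof. by rewrite /clamp => /andP[h1 h2]; rewrite min_l// max_r. Qed.

Lemma clamp_dist lo hi c d : `|clamp lo hi c - clamp lo hi d| <= `|c - d|.
Proof.
rewrite /clamp ler_norml; have := ler_norm (c - d).
have := ler_norm (d - c); rewrite distrC; move: `|c - d| => z h1 h2.
case: (leP c hi) => h3; case: (leP d hi) => h4; case: (leP lo c) => h5;
  case: (leP lo d) => h6; case: (leP lo hi) => h7; lra.
Qed.

Definition norm1 x := dist1 x (fun=> 0).

Lemma norm1_dist x y : `|norm1 x - norm1 y| <= dist1 x y.
Proof.
rewrite /norm1 /dist1 -sumrB; apply: le_trans (ler_norm_sum _ _ _) _.
apply: ler_sum => i _; rewrite !subr0; exact: ler_dist_dist.
Qed.

Definition cutoff M x := clamp 0 1 (2 - norm1 x / M).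

Lemma cutoff_ge0_le1 M x : 0 <= cutoff M x <= 1.
Proof. exact: clamp_bounds. Qed.

Lemma cutoff_dist M x y : 0 < M -> `|cutoff M x - cutoff M y| <= M^-1 * dist1 x y.
Proof.
move=> M0; apply: le_trans (clamp_dist _ _ _ _) _.
have -> : (2 - norm1 x / M) - (2 - norm1 y / M) = - (norm1 x - norm1 y) * M^-1 by ring.
rewrite normrM normrN mulrC gtr0_norm ?invr_gt0// ler_wpM2l//.
  by rewrite invr_ge0 ltW.
exact: norm1_dist.
Qed.

Lemma cutoff_eq1 M x : 0 < M -> norm1 x <= M -> cutoff M x = 1.
Proof.
move=> M0; rewrite -[leRHS]mul1r -ler_pdivrMr// /cutoff /clamp => h.
by rewrite min_r ?max_r//; lra.
Qed.

Lemma cutoff_eq0 M x : 0 < M -> 2 * M <= norm1 x -> cutoff M x = 0.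
Proof.
move=> M0; rewrite -ler_pdivlMr// /cutoff /clamp => h.
by rewrite max_l// ge_min; apply/orP; left; lra.
Qed.

(** Where the cutoff is nonzero, the l1 norm and hence every coordinate is below [2 * M]. This
    transfers the energy identity from the clamped point to [x]. *)
Lemma cutoff_clamp M x i : 0 < M ->
  cutoff M x * clamp (- (2 * M)) (2 * M) (x i) = cutoff M x * x i.
Proof.
move=> M0; have [/cutoff_eq0 -> //|xM] := leP (2 * M) (norm1 x); first by rewrite !mul0r.
rewrite clamp_id//; rewrite -ler_norml; apply: le_trans (ltW xM).
by have := le_dist1 x (fun=> 0) i; rewrite subr0.
Qed.

Variable F : T -> (T -> R) -> R.
Hypothesis Fl : forall i, loclip (F i).

(** Clamping the argument makes [F] bounded and Lipschitz everywhere, so the product with the cutoff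
    is estimated without distinguishing whether the points lie inside or outside the ball. *)
Definition truncated M i x := cutoff M x * F i (fun j => clamp (- (2 * M)) (2 * M) (x j)).

Lemma truncated_lipschitz M : 0 < M ->
  exists2 L, 0 <= L & forall i x y, `|truncated M i x - truncated M i y| <= L * dist1 x y.
Proof.
move=> M0; have M2 : 0 <= 2 * M by rewrite mulr_ge0// ltW.
have each i : exists2 L, 0 <= L &
    forall x y, `|truncated M i x - truncated M i y| <= L * dist1 x y.
  have [L L0 FL] := Fl i (2 * M); have [B B0 FB] := loclip_bounded (2 * M) (Fl i).
  exists (M^-1 * B + L); first by rewrite addr_ge0// mulr_ge0// invr_ge0 ltW.
  move=> x y; rewrite /truncated.
  set Fx := F i (fun j => clamp (- (2 * M)) (2 * M) (x j)).
  set Fy := F i (fun j => clamp (- (2 * M)) (2 * M) (y j)).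
  have -> : cutoff M x * Fx - cutoff M y * Fy =
    (cutoff M x - cutoff M y) * Fx + cutoff M y * (Fx - Fy) by ring.
  apply: le_trans (ler_normD _ _) _; rewrite !normrM mulrDl; apply: lerD.
    rewrite mulrAC ler_pM//; first exact: cutoff_dist.
    by apply: FB => j; rewrite ler_norml clamp_bounds// ge0_cp.
  have /andP[c0 c1] := cutoff_ge0_le1 M y.
  rewrite (ger0_norm c0) -[leRHS]mul1r ler_pM//.
  apply: le_trans (FL _ _ _ _) _; try by move=> j; rewrite ler_norml clamp_bounds// ge0_cp.
  by apply: ler_wpM2l => //; apply: ler_sum => j _; exact: clamp_dist.
pose Li i := sval (cid2 (each i)).
have LiP i : 0 <= Li i /\
    forall x y, `|truncated M i x - truncated M i y| <= Li i * dist1 x y.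
  by rewrite /Li; case: cid2.
exists (\sum_i Li i); first by apply: sumr_ge0 => i _; have [] := LiP i.
move=> i x y; have [_ h] := LiP i; apply: le_trans (h x y) _.
apply: ler_wpM2r; first exact: dist1_ge0.
by rewrite (bigD1 i)//= lerDl sumr_ge0// => j _; have [] := LiP j.
Qed.

(* The weighted energy is conserved by the truncated system too, so its solution never
   reaches the region where the truncation is active. *)
Theorem global_solution (a : T -> R) (x0 : T -> R) :
  (forall i, 1 <= a i) -> (forall x, \sum_i a i * x i * F i x = 0) ->
  exists w : T -> R -> R, (forall i, w i 0 = x0 i) /\
    forall i (t : R), 0 <= t -> is_derive t 1 (w i) (F i (w^~ t)).
Proof.
move=> a1 aF; pose E0 := \sum_i a i * x0 i ^+ 2.
have E00 : 0 <= E0.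
  by apply: sumr_ge0 => i _; rewrite mulr_ge0 ?sqr_ge0// (le_trans _ (a1 i)).
(* As the weights are at least 1, energy at most [E0] forces each squared coordinate below [E0],
   hence each coordinate below [1 + E0] in absolute value; summing gives the l1 bound, and the last
   1 makes [M] positive. *)
pose M := #|T|%:R * (1 + E0) + 1.
have M0 : 0 < M by rewrite ltr_wpDl// mulr_ge0// addr_ge0.
have [L L0 GL] := truncated_lipschitz M0.
have [w [w0 wd]] := lipschitz_solution L0 GL x0; exists w; split => // i t t0.
suff wM s : 0 <= s -> norm1 (w^~ s) <= M.
  have <- : truncated M i (w^~ t) = F i (w^~ t); last exact: wd.
  rewrite /truncated cutoff_eq1 ?wM// mul1r; congr (F i _); apply/funext => j.
  apply: clamp_id; rewrite -ler_norml; apply: le_trans (_ : norm1 (w^~ t) <= _).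
    by have := le_dist1 (w^~ t) (fun=> 0) j; rewrite subr0.
  by apply: le_trans (wM _ t0) _; lra.
move=> {i t t0} s0.
have energy : \sum_i a i * w i s ^+ 2 <= E0.
  pose f (t : R) := - \sum_i a i * w i t ^+ 2.
  rewrite -lerN2 (_ : - E0 = f 0); last first.
    by rewrite /f /E0; congr (- _); apply: eq_bigr => i _; rewrite w0.
  apply: (@ge0_derive_le _ f (fun=> 0)) => // t t0.
  have h i : is_derive t 1 (fun t => a i * w i t ^+ 2)
      (2 * (a i * w i t * truncated M i (w^~ t))).
    have -> : (fun t => a i * w i t ^+ 2) = a i \*: (w i ^+ 2) by [].
    have := wd i t t0 => d; apply: is_derive_eq.
    by rewrite /GRing.scale/= expr1; ring.
  rewrite /f.
  have -> : (fun t => - \sum_i a i * w i t ^+ 2) =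
     - (fun t => \sum_i a i * w i t ^+ 2) by [].
  apply: (is_derive_eq (is_deriveN (is_derive_bigsum _ h))).
  rewrite -mulr_sumr.
  (* The hypothesis [aF] is used at the clamped point: the cutoff carried by the truncated field
     lets [w i t] be replaced by its clamp. *)
  rewrite (eq_bigr (fun i => cutoff M (w^~ t) *
      (a i * clamp (- (2 * M)) (2 * M) (w i t) *
       F i (fun j => clamp (- (2 * M)) (2 * M) (w j t))))).
    by rewrite -mulr_sumr aF !mulr0 oppr0.
  move=> i _; rewrite /truncated; set Fi := F i _.
  rewrite [RHS](_ : _ = a i * Fi * (cutoff M (w^~ t) *
      clamp (- (2 * M)) (2 * M) (w i t))); last by ring.
  by rewrite (cutoff_clamp (w^~ t))//; ring.
have wE i : `|w i s - 0| <= 1 + E0.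
  rewrite subr0; have : w i s ^+ 2 <= E0.
    apply: le_trans energy; rewrite (bigD1 i)//=.
    apply: le_trans (_ : a i * w i s ^+ 2 <= _); first by rewrite ler_peMl ?sqr_ge0.
    rewrite lerDl sumr_ge0// => j _.
    by rewrite mulr_ge0 ?sqr_ge0// (le_trans _ (a1 j)).
  rewrite -real_normK ?num_real//; move: `|_| (normr_ge0 (w i s)) => z z0 zE.
  by nra.
by apply: le_trans (dist1_le_const wE) _; rewrite /M lerDl.
Qed.

(** A Gronwall argument: the squared distance times [expR (- l * s)] is nonincreasing and starts at
    0. Continuity on the compact interval [[0, b]] supplies the ball whose Lipschitz constant is
    used. Derivatives are required at positive times only, since a Galerkin solution is one-sided at
    0. *)
Theorem loclip_uniqueness (v w : T -> R -> R) :
  (forall i, {within `[0, +oo[, continuous (v i)}) ->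
  (forall i, {within `[0, +oo[, continuous (w i)}) ->
  (forall i (t : R), 0 < t -> is_derive t 1 (v i) (F i (v^~ t))) ->
  (forall i (t : R), 0 < t -> is_derive t 1 (w i) (F i (w^~ t))) ->
  (forall i, v i 0 = w i 0) -> forall i (t : R), 0 <= t -> v i t = w i t.
Proof.
move=> vc wc vd wd v0 i0 b b0.
have sub : (`[0, b] : set R) `<=` `[0, +oo[ by apply: subset_itvl.
have bnd (u : T -> R -> R) : (forall i, {within `[0, +oo[, continuous (u i)}) ->
    exists2 M : R, 0 <= M & forall i s, 0 <= s <= b -> `|u i s| <= M.
  move=> uc; have each i : exists2 M : R, 0 <= M & forall s, 0 <= s <= b -> `|u i s| <= M.
    have nc : {within `[0, b], continuous (fun s => `|u i s|)}.
      have ucb := continuous_subspaceW sub (uc i).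
      by move=> x; apply: cvg_norm; exact: ucb.
    by have [c _ cP] := EVT_max b0 nc; exists `|u i c| => // s; exact: cP.
  pose Mi i := sval (cid2 (each i)).
  have MiP i : 0 <= Mi i /\ forall s, 0 <= s <= b -> `|u i s| <= Mi i.
    by rewrite /Mi; case: cid2.
  exists (\sum_i Mi i); first by apply: sumr_ge0 => i _; have [] := MiP i.
  move=> i s sb; have [_ h] := MiP i; apply: le_trans (h s sb) _.
  by rewrite (bigD1 i)//= lerDl sumr_ge0// => j _; have [] := MiP j.
have [Mv Mv0 vM] := bnd v vc; have [Mw Mw0 wM] := bnd w wc.
pose M := Mv + Mw.
have {bnd} [L L0 FL] : exists2 L, 0 <= L & forall i x y,
    (forall i, `|x i| <= M) -> (forall i, `|y i| <= M) ->
    `|F i x - F i y| <= L * dist1 x y.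
  pose Li i := sval (cid2 (Fl i M)).
  have LiP i : 0 <= Li i /\ forall x y,
      (forall i, `|x i| <= M) -> (forall i, `|y i| <= M) ->
      `|F i x - F i y| <= Li i * dist1 x y.
    by rewrite /Li; case: cid2.
  exists (\sum_i Li i); first by apply: sumr_ge0 => i _; have [] := LiP i.
  move=> i x y xM yM; have [_ h] := LiP i; apply: le_trans (h x y xM yM) _.
  apply: ler_wpM2r; first exact: dist1_ge0.
  by rewrite (bigD1 i)//= lerDl sumr_ge0// => j _; have [] := LiP j.
pose l := 2 * L * #|T|%:R.
pose D (s : R) := \sum_i (v i s - w i s) ^+ 2.
pose f : R -> R := (fun s => expR (- l * s)) * D.
pose dD (s : R) := \sum_i 2 * ((v i s - w i s) * (F i (v^~ s) - F i (w^~ s))).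
have Dd (s : R) : 0 < s -> is_derive s 1 D (dD s).
  move=> s0; apply: is_derive_bigsum => i.
  have -> : (fun s => (v i s - w i s) ^+ 2) = (v i - w i) ^+ 2 by [].
  have := vd i s s0; have := wd i s s0 => d1 d2; apply: is_derive_eq.
  by rewrite /GRing.scale/= expr1 !fctE; ring.
have fd (s : R) : 0 < s ->
    is_derive s 1 f (expR (- l * s) * (dD s - l * D s)).
  move=> s0; have := Dd s s0; have := is_derive_expRM (- l) s => d1 d2.
  by apply: is_derive_eq; rewrite /GRing.scale/=; ring.
have dD_le s : 0 <= s <= b -> dD s <= l * D s.
  move=> sb; rewrite /dD.
  (* Each product of two coordinate differences is absorbed by the sum of their squares; summing
     over all pairs counts every square [2 * #|T|] times, whence the rate [l]. *)
  apply: (@le_trans _ _ (\sum_i \sum_j L * ((v i s - w i s) ^+ 2 + (v j s - w j s) ^+ 2))).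
    apply: ler_sum => i _.
    apply: (@le_trans _ _ (2 * (`|v i s - w i s| * (L * dist1 (v^~ s) (w^~ s))))).
      rewrite ler_wpM2l//; apply: le_trans (ler_norm _) _; rewrite normrM ler_wpM2l//.
      apply: FL => j; first by apply: le_trans (vM j s sb) _; rewrite lerDl.
      by apply: le_trans (wM j s sb) _; rewrite lerDr.
    rewrite (_ : 2 * _ = \sum_j L * (2 * (`|v i s - w i s| * `|v j s - w j s|))); last first.
      by rewrite /dist1 !mulr_sumr; apply: eq_bigr => j _; ring.
    apply: ler_sum => j _; apply: ler_wpM2l => //.
    rewrite -(real_normK (num_real (v i s - w i s))) -(real_normK (num_real (v j s - w j s))).
    move: `|v i s - w i s| `|v j s - w j s| => z1 z2.
    by have := sqr_ge0 (z1 - z2); nra.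
  rewrite le_eqVlt; apply/orP; left; apply/eqP.
  under eq_bigr do rewrite -mulr_sumr big_split/= sumr_const -mulr_natl.
  rewrite -mulr_sumr big_split/= -mulr_sumr sumr_const -mulr_natl /l /D; ring.
have D0 : D 0 = 0 by apply: big1 => i _; rewrite v0 subrr expr0n.
have Dc : {within `[0, b], continuous D}.
  move=> x; apply: cvg_big; first exact: add_continuous.
  move=> i _; have vcb := continuous_subspaceW sub (vc i).
  have wcb := continuous_subspaceW sub (wc i).
  apply: cvgM; apply: cvgB.
  - exact: vcb.
  - exact: wcb.
  - exact: vcb.
  - exact: wcb.
have fc : {within `[0, b], continuous f}.
  move=> x; apply: cvgM; last exact: Dc.
  apply: (@continuous_subspaceT _ _ `[0, b] (fun s => expR (- l * s))) => y.
  apply: differentiable_continuous; apply/derivable1_diffP.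
  by have [] := is_derive_expRM (- l) y.
have fdiff (x : R) : x \in `]0, b[ -> derivable f x 1.
  by rewrite in_itv/= => /andP[x0 _]; have [] := fd x x0.
have f'le0 (x : R) : x \in `]0, b[ -> derive1 f x <= 0.
  rewrite in_itv/= => /andP[x0 xb]; rewrite derive1E.
  have [_ ->] := fd x x0; rewrite mulr_ge0_le0 ?expR_ge0// subr_le0 dD_le//.
  by rewrite !ltW.
have b_in : b \in `[0, b] by rewrite in_itv/= b0 lexx.
have z_in : 0 \in `[0, b] by rewrite in_itv/= b0 lexx.
have := ler0_derive1_le_cc fdiff f'le0 fc b_in z_in b0.
rewrite /f !fctE D0 mulr0 pmulr_rle0 ?expR_gt0// => Db.
apply/eqP; rewrite -subr_eq0 -sqrf_eq0 eq_le sqr_ge0 andbT; apply: le_trans Db.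
by rewrite /D (bigD1 i0)//= lerDl sumr_ge0// => j _; rewrite sqr_ge0.
Qed.

End LocallyLipschitz.

(** * Fourier coefficients of trigonometric polynomials *)

Section ComplexIntegral.
Variable R : realType.
Local Notation C := R[i].
Local Notation Re := (@complex.Re R).
Local Notation Im := (@complex.Im R).
Local Notation mu := (@lebesgue_measure R).
Implicit Types (f g : R -> C) (h : R -> R) (z w : C) (j k : int) (x : R).

Lemma complex_eqP z w : Re z = Re w -> Im z = Im w -> z = w.
Proof. by case: z w => [a b] [c d] /= -> ->. Qed.

Lemma ReD z w : Re (z + w) = Re z + Re w. Proof. by case: z w => [? ?] []. Qed.
Lemma ImD z w : Im (z + w) = Im z + Im w. Proof. by case: z w => [? ?] []. Qed.
Lemma ReN z : Re (- z) = - Re z. Proof. by case: z. Qed.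
Lemma ImN z : Im (- z) = - Im z. Proof. by case: z. Qed.
Lemma ReM z w : Re (z * w) = Re z * Re w - Im z * Im w.
Proof. by case: z w => [? ?] []. Qed.
Lemma ImM z w : Im (z * w) = Re z * Im w + Im z * Re w.
Proof. by case: z w => [? ?] []. Qed.
Lemma Re_conj z : Re z^* = Re z. Proof. by case: z. Qed.
Lemma Im_conj z : Im z^* = - Im z. Proof. by case: z. Qed.
Lemma Re_sum (I : Type) (r : seq I) (F : I -> C) :
  Re (\sum_(i <- r) F i) = \sum_(i <- r) Re (F i).
Proof. exact: (big_morph _ ReD). Qed.
Lemma Im_sum (I : Type) (r : seq I) (F : I -> C) :
  Im (\sum_(i <- r) F i) = \sum_(i <- r) Im (F i).
Proof. exact: (big_morph _ ImD). Qed.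
Definition ReImE := (ReD, ImD, ReN, ImN, ReM, ImM, Re_conj, Im_conj).

(** Componentwise, to match [Cintegral]; on the compact torus it supplies the integrability that
    linearity of the integral requires. *)
Definition ccont f := continuous (Re \o f) /\ continuous (Im \o f).

Lemma ccont_cst z : ccont (fun=> z).
Proof. by split => x; exact: cvg_cst. Qed.

Lemma ccontD f g : ccont f -> ccont g -> ccont (fun x => f x + g x).
Proof.
move=> [f1 f2] [g1 g2]; split.
- have -> : Re \o (fun x => f x + g x) = (Re \o f) \+ (Re \o g).
    by apply/funext => x /=; rewrite ReD.
  by move=> x; apply: cvgD; [exact: f1|exact: g1].
- have -> : Im \o (fun x => f x + g x) = (Im \o f) \+ (Im \o g).
    by apply/funext => x /=; rewrite ImD.
  by move=> x; apply: cvgD; [exact: f2|exact: g2].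
Qed.

Lemma ccontM f g : ccont f -> ccont g -> ccont (fun x => f x * g x).
Proof.
move=> [f1 f2] [g1 g2]; split.
- have -> : Re \o (fun x => f x * g x) =
    ((Re \o f) \* (Re \o g)) \- ((Im \o f) \* (Im \o g)).
    by apply/funext => x /=; rewrite ReM.
  by move=> x; apply: cvgB; apply: cvgM; [exact: f1|exact: g1|exact: f2|exact: g2].
- have -> : Im \o (fun x => f x * g x) =
    ((Re \o f) \* (Im \o g)) \+ ((Im \o f) \* (Re \o g)).
    by apply/funext => x /=; rewrite ImM.
  by move=> x; apply: cvgD; apply: cvgM; [exact: f1|exact: g2|exact: f2|exact: g1].
Qed.

Lemma ccont_sum (I : Type) (r : seq I) (F : I -> R -> C) :
  (forall i, ccont (F i)) -> ccont (fun x => \sum_(i <- r) F i x).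
Proof.
move=> Fc; elim: r => [|i r IH].
  under eq_fun do rewrite big_nil.
  exact: ccont_cst.
under eq_fun do rewrite big_cons.
exact: ccontD.
Qed.

Lemma continuous_torus_integrable h : continuous h -> mu.-integrable (@torus R) (EFin \o h).
Proof.
move=> hc; apply: (@continuous_compact_integrable R h); first exact: segment_compact.
exact: continuous_subspaceT.
Qed.

Lemma CintegralD f g : ccont f -> ccont g ->
  Cintegral (fun x => f x + g x) = Cintegral f + Cintegral g.
Proof.
move=> [f1 f2] [g1 g2]; have mT : measurable (@torus R) by exact: measurable_itv.
apply: complex_eqP; rewrite ?ReImE /=.
- rewrite -RintegralD//; try exact: continuous_torus_integrable.
  by apply: eq_Rintegral => x _; rewrite ReD.
- rewrite -RintegralD//; try exact: continuous_torus_integrable.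
  by apply: eq_Rintegral => x _; rewrite ImD.
Qed.

Lemma CintegralZ z f : ccont f -> Cintegral (fun x => z * f x) = z * Cintegral f.
Proof.
move=> [f1 f2]; have mT : measurable (@torus R) by exact: measurable_itv.
have f1i := continuous_torus_integrable f1; have f2i := continuous_torus_integrable f2.
have cZ (a : R) h : continuous h -> continuous (fun x => a * h x).
  by move=> hc x; apply: cvgM; [exact: cvg_cst|exact: hc].
apply: complex_eqP; rewrite ?ReImE /=.
- rewrite -!RintegralZl// -RintegralB//; try exact/continuous_torus_integrable/cZ.
  by apply: eq_Rintegral => x _; rewrite ReM.
- rewrite -!RintegralZl// -RintegralD//; try exact/continuous_torus_integrable/cZ.
  by apply: eq_Rintegral => x _; rewrite ImM.
Qed.

Lemma Cintegral0 : Cintegral (fun=> 0 : C) = 0.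
Proof. by rewrite /Cintegral/= Rintegral_cst ?mul0r//; exact: measurable_itv. Qed.

Lemma Cintegral_sum (I : Type) (r : seq I) (F : I -> R -> C) :
  (forall i, ccont (F i)) ->
  Cintegral (fun x => \sum_(i <- r) F i x) = \sum_(i <- r) Cintegral (F i).
Proof.
move=> Fc; elim: r => [|i r IH].
  rewrite big_nil -[RHS]Cintegral0; congr Cintegral.
  by apply/funext => x; rewrite big_nil.
rewrite big_cons -IH -CintegralD//; last exact: ccont_sum.
by congr Cintegral; apply/funext => x; rewrite big_cons.
Qed.

Lemma Rintegral_torus h (H : R -> R) : continuous h ->
  (forall x, is_derive x 1 H (h x)) ->
  (\int[mu]_(x in @torus R) h x)%R = H pi - H (- pi).
Proof.
move=> hc Hd; have p0 : - pi < pi :> R by rewrite gtrN// pi_gt0.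
have Hc x : H @ x --> H x.
  by apply: differentiable_continuous; apply/derivable1_diffP; have [] := Hd x.
rewrite /Rintegral (@continuous_FTC2 R h H) //.
- exact: continuous_subspaceT.
- split; [by move=> x _; have [] := Hd x| |].
  + exact: cvg_at_right_filter.
  + exact: cvg_at_left_filter.
- by move=> x _; rewrite derive1E; have [_ ->] := Hd x.
Qed.

Lemma expiD j k x : @expi R j x * @expi R k x = @expi R (j + k) x.
Proof.
apply: complex_eqP; rewrite ?ReImE /= intrD mulrDl ?cosD ?sinD//.
by rewrite addrC.
Qed.

Lemma expi0 x : @expi R 0 x = 1.
Proof. by rewrite /expi mul0r cos0 sin0. Qed.

Lemma conj_expi k x : (@expi R k x)^* = @expi R (- k) x.
Proof. by apply: complex_eqP; rewrite ?ReImE /= intrN mulNr ?cosN ?sinN. Qed.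

Lemma is_derive_sinM (a : R) x : is_derive x 1 (fun x => sin (a * x)) (a * cos (a * x)).
Proof.
rewrite mulrC.
exact: (@is_derive1_comp R sin ( *%R a) x _ _ (is_derive_sin _) (is_derive_mulr _ _)).
Qed.

Lemma is_derive_cosM (a : R) x : is_derive x 1 (fun x => cos (a * x)) (- a * sin (a * x)).
Proof.
rewrite mulNr -mulrN mulrC.
exact: (@is_derive1_comp R cos ( *%R a) x _ _ (is_derive_cos _) (is_derive_mulr _ _)).
Qed.

Lemma ccont_expi k : ccont (@expi R k).
Proof.
split => x; apply: differentiable_continuous; apply/derivable1_diffP.
  by have [] := is_derive_cosM k%:~R x.
by have [] := is_derive_sinM k%:~R x.
Qed.

Lemma sin_intpi k : sin (k%:~R * pi) = 0 :> R.
Proof.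
have nat_case n : sin (n%:R * pi) = 0 :> R.
  elim: n => [|n IH]; first by rewrite mul0r sin0.
  by rewrite -addn1 natrD mulrDl mul1r sinDpi IH oppr0.
case: k => n; first exact: nat_case.
by rewrite NegzE intrN mulNr sinN nat_case oppr0.
Qed.

(** For nonzero [k] the antiderivatives of both components agree at the two endpoints: sine vanishes
    at integer multiples of pi, and cosine is even. *)
Lemma Cintegral_expi k : Cintegral (@expi R k) = if k == 0 then (2 * pi)%:C else 0.
Proof.
have [->|k0] := eqVneq k 0.
  rewrite /Cintegral; have mT : measurable (@torus R) by exact: measurable_itv.
  have -> : (\int[mu]_(x in @torus R) Re (@expi R 0 x))%R = 2 * pi.
    have -> : 2 * pi = pi - - pi :> R by ring.
    apply: (@Rintegral_torus (fun x => Re (@expi R 0 x)) id) => [x|x].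
      under eq_fun do rewrite expi0.
      exact: cvg_cst.
    by rewrite expi0 /=; exact: is_derive_id.
  have -> // : (\int[mu]_(x in @torus R) Im (@expi R 0 x))%R = 0.
  under eq_Rintegral do rewrite expi0.
  by rewrite Rintegral_cst// mul0r.
have k0' : k%:~R != 0 :> R by rewrite intr_eq0.
have [c1 c2] := ccont_expi k.
apply: complex_eqP => /=.
- have dsin x : is_derive x 1 (k%:~R^-1 \*: (fun x => sin (k%:~R * x))) (cos (k%:~R * x)).
    have := is_derive_sinM k%:~R x => d; apply: is_derive_eq.
    by rewrite /GRing.scale/= mulKf.
  by rewrite (Rintegral_torus c1 dsin) /= mulrN sinN sin_intpi oppr0 subrr.
- have dcos x : is_derive x 1 ((- k%:~R^-1) \*: (fun x => cos (k%:~R * x))) (sin (k%:~R * x)).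
    have := is_derive_cosM k%:~R x => d; apply: is_derive_eq.
    by rewrite /GRing.scale/= !mulNr mulrN opprK mulKf.
  by rewrite (Rintegral_torus c2 dcos) /= mulrN cosN subrr.
Qed.

End ComplexIntegral.

(** * Orthogonality, derivatives and multipliers on trigonometric polynomials *)

Section TrigonometricPolynomials.
Variable R : realType.
Local Notation C := R[i].
Local Notation Re := (@complex.Re R).
Local Notation Im := (@complex.Im R).
Implicit Types (I J : finType) (f g : R -> C) (j k : int) (x : R) (N : nat).

(** The index type is arbitrary and [z] may repeat frequencies, so that a product of two such sums
    is again one, indexed by pairs with added frequencies. *)
Definition trig I (z : I -> int) (a : I -> C) x : C := \sum_i a i * expi (z i) x.

Lemma ccont_trig I z a : ccont (@trig I z a).
Proof.
by apply: ccont_sum => i; apply: ccontM; [exact: ccont_cst|exact: ccont_expi].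
Qed.

Lemma pi2_neq0 : (2 * pi)%:C != 0 :> C.
Proof. by rewrite eq_complex/= eqxx andbT mulf_neq0// gt_eqF// pi_gt0. Qed.

Lemma pi2_fourier f k : (2 * pi)%:C * fourier f k = Cintegral (fun x => f x * expi (- k) x).
Proof.
rewrite /fourier mulrA -rmorphM/= mulfV ?mul1r//.
by rewrite mulf_neq0// gt_eqF// pi_gt0.
Qed.

Lemma fourierD f g k : ccont f -> ccont g ->
  fourier (fun x => f x + g x) k = fourier f k + fourier g k.
Proof.
move=> fc gc; have ec := ccont_expi R (- k).
rewrite /fourier -mulrDr -CintegralD; try exact: ccontM.
by congr (_ * Cintegral _); apply/funext => x; rewrite mulrDl.
Qed.

Lemma fourierZ c f k : ccont f -> fourier (fun x => c * f x) k = c * fourier f k.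
Proof.
move=> fc; have fe : ccont (fun x => f x * expi (- k) x).
  by apply: ccontM => //; exact: ccont_expi.
rewrite /fourier mulrCA -(CintegralZ c fe).
by congr (_ * Cintegral _); apply/funext => x; rewrite mulrA.
Qed.

Lemma fourier_trig I z a k : fourier (@trig I z a) k = \sum_i (z i == k)%:R * a i.
Proof.
apply: (mulfI pi2_neq0); rewrite pi2_fourier mulr_sumr.
have -> : (fun x => trig z a x * expi (- k) x) =
    (fun x => \sum_i a i * @expi R (z i - k) x).
  by apply/funext => x; rewrite mulr_suml; apply: eq_bigr => i _; rewrite -mulrA expiD.
rewrite Cintegral_sum => [|i].
  apply: eq_bigr => i _; rewrite CintegralZ; last exact: ccont_expi.
  rewrite Cintegral_expi subr_eq0; case: eqP => _; last by rewrite mul0r !mulr0.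
  by rewrite mul1r mulrC.
by apply: ccontM; [exact: ccont_cst|exact: ccont_expi].
Qed.

Lemma fourier_trig_inj I z a i : injective z -> fourier (@trig I z a) (z i) = a i.
Proof.
move=> zi; rewrite fourier_trig (bigD1 i)//= eqxx mul1r big1 ?addr0// => j ji.
by rewrite (inj_eq zi) (negbTE ji) mul0r.
Qed.

Lemma fourier_trigM I z a J w b k : fourier (fun x => @trig I z a x * @trig J w b x) k =
  \sum_i \sum_j (z i + w j == k)%:R * (a i * b j).
Proof.
rewrite pair_big/= -(fourier_trig (fun p : I * J => z p.1 + w p.2) (fun p => a p.1 * b p.2)).
congr (fourier _ k); apply/funext => x; rewrite /trig mulr_suml.
under eq_bigr do rewrite mulr_sumr.
rewrite pair_big/=; apply: eq_bigr => p _.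
by rewrite mulrACA expiD.
Qed.

(** Only the second argument is a trigonometric sum over [z]: the nonlinear terms leave [VN], and
    testing sees just their coefficients at the frequencies of the test function. *)
Lemma inner_trigr f I z a : ccont f ->
  inner f (@trig I z a) = (2 * pi)%:C * \sum_i (a i)^* * fourier f (z i).
Proof.
move=> fc; rewrite mulr_sumr /inner.
have -> : (fun x => f x * (trig z a x)^*) =
    (fun x => \sum_i (a i)^* * (f x * @expi R (- z i) x)).
  apply/funext => x; rewrite /trig rmorph_sum mulr_sumr; apply: eq_bigr => i _.
  by rewrite rmorphM/= conj_expi mulrCA.
rewrite Cintegral_sum => [|i].
  apply: eq_bigr => i _; rewrite CintegralZ; last by apply: ccontM => //; exact: ccont_expi.
  by rewrite mulrCA pi2_fourier.
by apply: ccontM; [exact: ccont_cst|apply: ccontM => //; exact: ccont_expi].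
Qed.

Lemma is_derive_Re_trig I z a x : is_derive x 1 (Re \o @trig I z a)
  (\sum_i Re ('i * (z i)%:~R * a i * expi (z i) x)).
Proof.
have -> : Re \o trig z a =
    (fun x => \sum_i (Re (a i) * cos ((z i)%:~R * x) - Im (a i) * sin ((z i)%:~R * x))).
  by apply/funext => y /=; rewrite Re_sum; apply: eq_bigr => i _; rewrite ReM.
apply: is_derive_bigsum => i.
have := is_derive_cosM (z i)%:~R x; have := is_derive_sinM (z i)%:~R x => d1 d2.
have -> : (fun x => Re (a i) * cos ((z i)%:~R * x) - Im (a i) * sin ((z i)%:~R * x)) =
  Re (a i) \*: (fun x => cos ((z i)%:~R * x)) - Im (a i) \*: (fun x => sin ((z i)%:~R * x)) by [].
apply: is_derive_eq; rewrite -(rmorph_int (@real_complex R)) !ReImE /GRing.scale/=.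
by ring.
Qed.

Lemma is_derive_Im_trig I z a x : is_derive x 1 (Im \o @trig I z a)
  (\sum_i Im ('i * (z i)%:~R * a i * expi (z i) x)).
Proof.
have -> : Im \o trig z a =
    (fun x => \sum_i (Re (a i) * sin ((z i)%:~R * x) + Im (a i) * cos ((z i)%:~R * x))).
  by apply/funext => y /=; rewrite Im_sum; apply: eq_bigr => i _; rewrite ImM.
apply: is_derive_bigsum => i.
have := is_derive_cosM (z i)%:~R x; have := is_derive_sinM (z i)%:~R x => d1 d2.
have -> : (fun x => Re (a i) * sin ((z i)%:~R * x) + Im (a i) * cos ((z i)%:~R * x)) =
  Re (a i) \*: (fun x => sin ((z i)%:~R * x)) + Im (a i) \*: (fun x => cos ((z i)%:~R * x)) by [].
apply: is_derive_eq; rewrite -(rmorph_int (@real_complex R)) !ReImE /GRing.scale/=.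
by ring.
Qed.

Lemma dx_trig I z a : dx (@trig I z a) = trig z (fun i => 'i * (z i)%:~R * a i).
Proof.
apply/funext => x; apply: complex_eqP.
  by rewrite /= derive1E; have [_ ->] := is_derive_Re_trig z a x; rewrite /trig Re_sum.
by rewrite /= derive1E; have [_ ->] := is_derive_Im_trig z a x; rewrite /trig Im_sum.
Qed.

Lemma fracLap_trig alpha I z a :
  fracLap alpha (@trig I z a) = trig z (fun i => (`|z i|%:~R `^ alpha)%:C * a i).
Proof.
apply/funext => x; rewrite /fracLap.
(* Coefficients vanish off the range of [z], so the sum over all integers reduces to this list;
   duplicates are removed because [z] may repeat values. *)
pose r := undup [seq z i | i <- enum I].
have rz i : z i \in r by rewrite mem_undup map_f// mem_enum.
have ru : uniq r by exact: undup_uniq.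
rewrite (fsbigE (A := setT) r)//; last first.
  move=> k _ kr; rewrite fourier_trig big1 ?mulr0 ?mul0r// => i _.
  case: eqP => [zk|_]; last by rewrite mul0r.
  by move: kr; rewrite -zk rz.
under eq_bigl do rewrite in_setT.
under eq_bigr do rewrite fourier_trig mulr_sumr mulr_suml.
rewrite exchange_big/=; apply: eq_bigr => i _.
rewrite (bigD1_seq (z i))//= eqxx mul1r big1 ?addr0// => k kz.
by rewrite eq_sym (negbTE kz) mul0r mulr0 mul0r.
Qed.

Lemma L2norm_trig I z a : injective z ->
  L2norm (@trig I z a) = Num.sqrt (2 * pi * \sum_i (Re (a i) ^+ 2 + Im (a i) ^+ 2)).
Proof.
move=> zi; rewrite /L2norm inner_trigr; last exact: ccont_trig.
congr Num.sqrt; rewrite ReM/= mul0r subr0 Re_sum; congr (_ * _); apply: eq_bigr => i _.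
by rewrite fourier_trig_inj// !ReImE; ring.
Qed.

Lemma trigB I z a b x : @trig I z a x - trig z b x = trig z (fun i => a i - b i) x.
Proof. by rewrite /trig -sumrB; apply: eq_bigr => i _; rewrite mulrBl. Qed.

(* [freq] enumerates -N, ..., N, so that [rev_ord] negates frequencies. *)
Definition freq N (i : 'I_(N + N).+1) : int := i%:Z - N%:Z.

Lemma freq_inj N : injective (@freq N).
Proof. by move=> i j /addIr [] /val_inj. Qed.

Lemma freq_rev N (i : 'I_(N + N).+1) : freq (rev_ord i) = - freq i.
Proof. by rewrite /freq /= subSS; have := ltn_ord i; lia. Qed.

Lemma fsum_modes N (F : int -> C) : \sum_(k \in modes N) F k = \sum_(i < (N + N).+1) F (freq i).
Proof.
pose r := [seq @freq N i | i <- enum 'I_(N + N).+1].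
have rE : modes N = [set` r].
  apply/seteqP; split => k /=.
    rewrite /modes/= => kN; have kl : (absz (k + N%:Z)%R < (N + N).+1)%N by lia.
    by apply/mapP; exists (Ordinal kl); [rewrite mem_enum|rewrite /freq/=; lia].
  by case/mapP => i _ ->; rewrite /modes/= /freq; have := ltn_ord i; lia.
rewrite rE -fsbig_seq; last by rewrite map_inj_uniq ?enum_uniq//; exact: freq_inj.
by rewrite big_map big_enum.
Qed.

Lemma VNP N f : VN N f <-> exists a, forall x, f x = trig (@freq N) a x.
Proof.
split=> [[c fE]|[a fE]].
  by exists (fun i => c (freq i)) => x; rewrite fE fsum_modes.
exists (fun k => fourier f k) => x.
have -> : f = trig (@freq N) a by apply/funext.
rewrite fsum_modes; apply: eq_bigr => i _.
by rewrite fourier_trig_inj//; exact: freq_inj.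
Qed.

Lemma PNE N f : PN N f = trig (@freq N) (fun i => fourier f (freq i)).
Proof. by apply/funext => x; rewrite /PN fsum_modes. Qed.

(** Negation swaps the positive and negative parts. When one of their integrals is infinite, both
    sides are 0 because [fine] sends infinities to 0. *)
Lemma RintegralN (D : set R) (h : R -> R) :
  (\int[@lebesgue_measure R]_(x in D) (- h x))%R =
  - (\int[@lebesgue_measure R]_(x in D) h x)%R.
Proof.
rewrite /Rintegral; under eq_integral do rewrite EFinN.
rewrite [in LHS]integralE [in RHS]integralE.
under eq_integral do rewrite (@funeposN _ _ (EFin \o h)).
under [X in fine (_ - X)]eq_integral do rewrite (@funenegN _ _ (EFin \o h)).
have swap (p n : \bar R) : (0 <= p)%E -> (0 <= n)%E -> fine (n - p)%E = - fine (p - n)%E.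
  by case: p n => [r| |] [s| |] //= _ _; rewrite ?oppr0// opprB.
by apply: swap; exact: integral_ge0.
Qed.

Lemma fourier_conj f k : (forall x, Im (f x) = 0) -> fourier f (- k) = (fourier f k)^*.
Proof.
move=> fR; rewrite /fourier rmorphM/=; congr (_ * _); first by symmetry; exact: conjc_real.
apply: complex_eqP; rewrite ?ReImE /=.
  apply: eq_Rintegral => x _; rewrite !ReM fR !mul0r !subr0 /= opprK intrN mulNr.
  by rewrite cosN.
rewrite -RintegralN; apply: eq_Rintegral => x _.
by rewrite !ImM fR !mul0r !addr0 /= opprK intrN mulNr sinN mulrN opprK.
Qed.

End TrigonometricPolynomials.

(** * The Galerkin system for the Fourier coefficients *)

Section GalerkinSystem.
Variables (R : realType) (N : nat).
Local Notation C := R[i].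
Local Notation Re := (@complex.Re R).
Local Notation Im := (@complex.Im R).
Local Notation I := ('I_(N + N).+1).
Local Notation z := (@freq N).
Implicit Types (a b c d : I -> C) (i j p q r : I).
Variables (alpha kappa1 kappa2 gamma : R).

(** The coefficient at [z j] of a product of two elements of [VN]; letting [j] range over the modes
    only is the projection made by the scheme. *)
Definition conv a b j : C := \sum_p \sum_q (z p + z q == z j)%:R * (a p * b q).

Definition dcoef a i : C := 'i * (z i)%:~R * a i.

Definition symb j : R := `|z j|%:~R `^ alpha.

Definition lapcoef a i : C := (symb i)%:C * a i.

(* The right-hand side of the scheme tested against [expi (z j)], divided by [2 * pi]. *)
Definition rhs c j : C :=
  - ('i * (z j)%:~R) * (kappa1%:C * c j + (3 / 2 * gamma)%:C * conv c c j)
  - kappa2%:C * (2 * ((symb j)%:C * conv c (dcoef c) j) + conv c (lapcoef (dcoef c)) j).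

Lemma fourier_nlflux c j :
  fourier (fun x => nlflux kappa1 gamma (trig z c x)) (z j) =
  kappa1%:C * c j + (3 / 2 * gamma)%:C * conv c c j.
Proof.
have cc := ccont_trig z c; have ccc := ccontM cc cc.
have -> : (fun x => nlflux kappa1 gamma (trig z c x)) =
    (fun x => kappa1%:C * trig z c x + (3 / 2 * gamma)%:C * (trig z c x * trig z c x)).
  by apply/funext => x; rewrite /nlflux expr2.
rewrite fourierD; [|by apply: ccontM => //; exact: ccont_cst..].
rewrite !fourierZ// fourier_trig_inj; last exact: freq_inj.
by rewrite fourier_trigM.
Qed.

Let sumrDE (T : finType) (F G : T -> C) :
  \sum_i F i + \sum_i G i = \sum_i (F i + G i).
Proof. by rewrite big_split. Qed.

(** Every inner product has a transform of the test function as second argument, so it is [2 * pi]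
    times a sum against the conjugates of [b]; the common factor cancels. *)
Lemma galerkin_identityE c d b :
  galerkin_identity alpha kappa1 kappa2 gamma (trig z c) (trig z d) (trig z b) <->
  \sum_j (b j)^* * ((1 + (symb j)%:C) * d j - rhs c j) = 0.
Proof.
have cT a := ccont_trig z a.
have cM a a' := ccontM (cT a) (cT a').
have zi := @freq_inj N.
rewrite /galerkin_identity !fracLap_trig !dx_trig fracLap_trig.
rewrite !inner_trigr//; last first.
  have -> : (fun x => nlflux kappa1 gamma (trig z c x)) =
      (fun x => kappa1%:C * trig z c x + (3 / 2 * gamma)%:C * (trig z c x * trig z c x)).
    by apply/funext => x; rewrite /nlflux expr2.
  by apply: ccontD; apply: ccontM => //; exact: ccont_cst.
set S1 := \sum_i _; set S2 := \sum_i _; set S3 := \sum_i _; set S4 := \sum_i _; set S5 := \sum_i _.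
set S := \sum_j _.
have SE : S = S1 + S2 - (S3 - kappa2%:C * (2 * S4 + S5)).
  rewrite /S1 /S2 /S3 /S4 /S5 !mulr_sumr !sumrDE mulr_sumr -!sumrB.
  apply: eq_bigr => j _.
  rewrite fourier_nlflux !fourier_trigM !fourier_trig_inj// -!/(conv _ _ _) /rhs.
  have -> : ((`|z j|%:~R `^ alpha)%:C * b j)^* = (symb j)%:C * (b j)^*.
    by rewrite rmorphM; congr (_ * _); exact: conjc_real.
  (* Conjugating the derivative of the test function produces the leading minus sign of [rhs]. *)
  have -> : ('i * (z j)%:~R * b j)^* = - ('i * (z j)%:~R) * (b j)^*.
    by rewrite !rmorphM/= rmorph_int conjCi mulNr.
  have -> : conv c (fun i => 'i * (z i)%:~R * c i) j = conv c (dcoef c) j by [].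
  have -> : conv c (fun i => (`|z i|%:~R `^ alpha)%:C * ('i * (z i)%:~R * c i)) j =
    conv c (lapcoef (dcoef c)) j by [].
  by ring.
have P0 := pi2_neq0 R; set P := (2 * pi)%:C in P0 *.
rewrite SE; split => [h|h].
  apply: (mulfI P0); rewrite mulr0 !mulrBr mulrDr h; ring.
apply/eqP; rewrite -subr_eq0; apply/eqP.
by transitivity (P * (S1 + S2 - (S3 - kappa2%:C * (2 * S4 + S5)))); [ring|rewrite h mulr0].
Qed.

(** * The energy identity and the preservation of Hermitian symmetry *)

Definition trilinear a b d : C :=
  \sum_p \sum_q \sum_r (z p + z q + z r == 0)%:R * (a p * b q * d r).

Lemma trilinearC a b d : trilinear a b d = trilinear b a d.
Proof.
rewrite /trilinear exchange_big/=; apply: eq_bigr => p _; apply: eq_bigr => q _.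
by apply: eq_bigr => r _; rewrite (addrC (z q)) (mulrC (a q)).
Qed.

Lemma trilinearAC a b d : trilinear a b d = trilinear a d b.
Proof.
apply: eq_bigr => p _; rewrite exchange_big/=; apply: eq_bigr => q _.
by apply: eq_bigr => r _; rewrite addrAC (mulrAC (a p)).
Qed.

(** Reversing [j] turns the constraint [z p + z q = z j] into a vanishing sum of three frequencies,
    symmetric in the three arguments. *)
Lemma sum_conv_rev a b d : \sum_j conv a b j * d (rev_ord j) = trilinear a b d.
Proof.
rewrite /trilinear (eq_bigr (fun j => \sum_p \sum_q
   (z p + z q == z j)%:R * (a p * b q * d (rev_ord j)))); last first.
  move=> j _; rewrite /conv mulr_suml; apply: eq_bigr => p _.
  by rewrite mulr_suml; apply: eq_bigr => q _; rewrite !mulrA.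
rewrite exchange_big/=; apply: eq_bigr => p _.
rewrite exchange_big/=; apply: eq_bigr => q _.
rewrite (reindex_inj rev_ord_inj)/=; apply: eq_bigr => r _.
by rewrite rev_ordK freq_rev -subr_eq0 opprK.
Qed.

(* Leibniz rule: [trilinear] is the integral of a product of three functions, and [dcoef]
   is the derivative. *)
Lemma trilinear_dcoef a b d :
  trilinear (dcoef a) b d + trilinear a (dcoef b) d + trilinear a b (dcoef d) = 0.
Proof.
rewrite /trilinear !sumrDE/= big1// => p _.
rewrite !sumrDE/= big1// => q _; rewrite !sumrDE/= big1// => r _.
case: eqP => [h|_]; last by rewrite !mul0r !addr0.
have : (z p)%:~R + (z q)%:~R + (z r)%:~R = 0 :> C by rewrite -!intrD h.
rewrite /= !mul1r /dcoef => h'.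
transitivity ('i * (a p * b q * d r) * ((z p)%:~R + (z q)%:~R + (z r)%:~R)); first by ring.
by rewrite h' mulr0.
Qed.

Lemma symb_rev j : symb (rev_ord j) = symb j.
Proof. by rewrite /symb freq_rev normrN. Qed.

Lemma lapcoef_dcoef a : lapcoef (dcoef a) = dcoef (lapcoef a).
Proof. by apply/funext => j; rewrite /lapcoef /dcoef; ring. Qed.

Lemma linear_energy c : \sum_j (z j)%:~R * (c j * c (rev_ord j)) = 0.
Proof.
set S := \sum_j _; suff : S = - S.
  by move/eqP; rewrite -subr_eq0 opprK -mulr2n mulrn_eq0/= => /eqP.
rewrite {1}/S (reindex_inj rev_ord_inj)/= -sumrN; apply: eq_bigr => j _.
by rewrite rev_ordK freq_rev intrN mulNr (mulrC (c _)).
Qed.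

(** The linear flux gives an odd sum. The quadratic flux gives the mean of [u^2 u_x], a third of the
    mean of the derivative of [u^3]. The [kappa2] bracket is the Leibniz rule for [u], [u] and the
    fractional Laplacian of [u], since that multiplier commutes with differentiation. *)
Lemma energy c : \sum_j rhs c j * c (rev_ord j) = 0.
Proof.
have h3 : trilinear c c (dcoef c) = 0.
  have := trilinear_dcoef c c c.
  rewrite (trilinearC (dcoef c)) (trilinearAC c (dcoef c)) -!mulr2n -mulrSr.
  by move/eqP; rewrite mulrn_eq0/= => /eqP.
have := trilinear_dcoef c c (lapcoef c); rewrite (trilinearC (dcoef c)) => h4.
transitivity (- ('i * kappa1%:C) * (\sum_j (z j)%:~R * (c j * c (rev_ord j)))
  + (3 / 2 * gamma)%:C * trilinear c c (dcoef c)
  - kappa2%:C * (2 * trilinear c (dcoef c) (lapcoef c) + trilinear c (lapcoef (dcoef c)) c)).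
  rewrite -!sum_conv_rev !mulr_sumr !sumrDE mulr_sumr -sumrB.
  apply: eq_bigr => j _; rewrite {1}/dcoef {1}/lapcoef freq_rev symb_rev intrN /rhs.
  by ring.
rewrite linear_energy h3 !mulr0 addr0 add0r lapcoef_dcoef (trilinearAC c (dcoef (lapcoef c))).
suff -> : 2 * trilinear c (dcoef c) (lapcoef c) + trilinear c c (dcoef (lapcoef c)) = 0.
  by rewrite mulr0 oppr0.
by rewrite -[RHS]h4 mulr_natl mulr2n.
Qed.

Definition hermitian a := forall j, a (rev_ord j) = (a j)^*.

Lemma hermitian_dcoef a : hermitian a -> hermitian (dcoef a).
Proof.
move=> ha j; rewrite /dcoef ha freq_rev !rmorphM/= rmorph_int conjCi intrN.
by rewrite mulrN !mulNr.
Qed.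

Lemma conj_real (x : R) : (x%:C)^* = x%:C :> C.
Proof. exact: conjc_real. Qed.

Lemma hermitian_lapcoef a : hermitian a -> hermitian (lapcoef a).
Proof. by move=> ha j; rewrite /lapcoef ha symb_rev rmorphM/= conj_real. Qed.

Lemma hermitian_conv a b : hermitian a -> hermitian b -> hermitian (conv a b).
Proof.
move=> ha hb j; rewrite /conv rmorph_sum/= (reindex_inj rev_ord_inj)/=.
apply: eq_bigr => p _; rewrite rmorph_sum/= (reindex_inj rev_ord_inj)/=.
apply: eq_bigr => q _; rewrite !rmorphM/= rmorph_nat ha hb !freq_rev -opprD.
by rewrite eqr_opp.
Qed.

Lemma hermitian_rhs c : hermitian c -> hermitian (rhs c).
Proof.
move=> hc j; have hd := hermitian_dcoef hc.
have h1 := hermitian_conv hc hc; have h2 := hermitian_conv hc hd.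
have h3 := hermitian_conv hc (hermitian_lapcoef hd).
rewrite /rhs hc h1 h2 h3 symb_rev freq_rev intrN.
rewrite !(rmorphB, rmorphM, rmorphD, rmorphN)/= !conj_real rmorph_int conjCi rmorph_nat.
by ring.
Qed.

Definition vfield c j : C := rhs c j / (1 + (symb j)%:C).

Lemma symb_ge0 j : 0 <= symb j. Proof. exact: powR_ge0. Qed.

Lemma symb1_neq0 j : 1 + (symb j)%:C != 0 :> C.
Proof.
by rewrite eq_complex/= addr0 eqxx andbT gt_eqF// ltr_pwDl// symb_ge0.
Qed.

Lemma vfield_rhs c j : (1 + (symb j)%:C) * vfield c j = rhs c j.
Proof. by rewrite mulrC divfK// symb1_neq0. Qed.

Lemma hermitian_vfield c : hermitian c -> hermitian (vfield c).
Proof.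
move=> /hermitian_rhs h j; rewrite /vfield h symb_rev rmorphM/= fmorphV.
by congr (_ / _); rewrite rmorphD rmorph1/= conj_real.
Qed.

Lemma galerkin_vfield c b :
  galerkin_identity alpha kappa1 kappa2 gamma (trig z c) (trig z (vfield c)) (trig z b).
Proof.
apply/galerkin_identityE; rewrite big1// => j _.
by rewrite vfield_rhs subrr mulr0.
Qed.

Lemma galerkin_vfield_unique c d :
  (forall b, galerkin_identity alpha kappa1 kappa2 gamma (trig z c) (trig z d) (trig z b)) ->
  d =1 vfield c.
Proof.
(* Testing with a single exponential isolates the equation of mode [j]. *)
move=> h j; have /galerkin_identityE := h (fun i => (i == j)%:R).
rewrite (bigD1 j)//= eqxx rmorph1 mul1r big1 ?addr0 => [/eqP|i /negbTE ->]; last first.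
  by rewrite rmorph0 mul0r.
rewrite subr_eq0 /vfield => /eqP <-; rewrite mulrC mulKf//; exact: symb1_neq0.
Qed.

End GalerkinSystem.

(** * Real coordinates and global existence for the coefficient system *)

Section RealForm.
Variables (R : realType) (N : nat).
Local Notation C := R[i].
Local Notation Re := (@complex.Re R).
Local Notation Im := (@complex.Im R).
Local Notation I := ('I_(N + N).+1).
Local Notation T := (I * bool)%type.
Local Notation z := (@freq N).
Implicit Types (c : I -> C) (x y : T -> R) (i j : I) (p : T).

Definition toC x i : C := x (i, false) +i* x (i, true).

Definition ofC c p : R := if p.2 then Im (c p.1) else Re (c p.1).

Lemma ofC_false c i : ofC c (i, false) = Re (c i). Proof. by []. Qed.

Lemma ofC_true c i : ofC c (i, true) = Im (c i). Proof. by []. Qed.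

Lemma ofCK c : toC (ofC c) = c.
Proof. by apply/funext => i; rewrite /toC /ofC /=; case: (c i). Qed.

Lemma toCK x : ofC (toC x) = x.
Proof. by apply/funext => -[i []]. Qed.

Definition cloclip (g : (T -> R) -> C) := loclip (Re \o g) /\ loclip (Im \o g).

Lemma cloclip_cst (c : C) : cloclip (fun=> c).
Proof. by split; exact: loclip_cst. Qed.

Lemma cloclip_toC i : cloclip (toC^~ i).
Proof. by split; exact: loclip_coord. Qed.

Lemma cloclip_conj g : cloclip g -> cloclip (fun x => (g x)^*).
Proof.
move=> [g1 g2]; split.
  by rewrite (_ : _ \o _ = Re \o g)//; apply/funext => x /=; rewrite Re_conj.
rewrite (_ : _ \o _ = (fun x => - (Im (g x)))); first exact: loclipN.
by apply/funext => x /=; rewrite Im_conj.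
Qed.

Lemma cloclipD g h : cloclip g -> cloclip h -> cloclip (fun x => g x + h x).
Proof.
move=> [g1 g2] [h1 h2]; split.
  rewrite (_ : _ \o _ = (fun x => Re (g x) + Re (h x))); first exact: loclipD.
  by apply/funext => x /=; rewrite ReD.
rewrite (_ : _ \o _ = (fun x => Im (g x) + Im (h x))); first exact: loclipD.
by apply/funext => x /=; rewrite ImD.
Qed.

Lemma cloclipM g h : cloclip g -> cloclip h -> cloclip (fun x => g x * h x).
Proof.
move=> [g1 g2] [h1 h2]; split.
  rewrite (_ : _ \o _ = (fun x => Re (g x) * Re (h x) + - (Im (g x) * Im (h x)))).
    by apply: loclipD; [|apply: loclipN]; exact: loclipM.
  by apply/funext => x /=; rewrite ReM.
rewrite (_ : _ \o _ = (fun x => Re (g x) * Im (h x) + Im (g x) * Re (h x))).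
  by apply: loclipD; exact: loclipM.
by apply/funext => x /=; rewrite ImM.
Qed.

Lemma cloclipZ (c : C) g : cloclip g -> cloclip (fun x => c * g x).
Proof. by apply: cloclipM; exact: cloclip_cst. Qed.

Lemma cloclip_sum (J : Type) (r : seq J) (g : J -> (T -> R) -> C) :
  (forall k, cloclip (g k)) -> cloclip (fun x => \sum_(k <- r) g k x).
Proof.
move=> gl; split.
  rewrite (_ : _ \o _ = (fun x => \sum_(k <- r) Re (g k x))).
    by apply: loclip_sum => k; have [] := gl k.
  by apply/funext => x /=; rewrite Re_sum.
rewrite (_ : _ \o _ = (fun x => \sum_(k <- r) Im (g k x))).
  by apply: loclip_sum => k; have [] := gl k.
by apply/funext => x /=; rewrite Im_sum.
Qed.

Variables (alpha kappa1 kappa2 gamma : R).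
Local Notation V := (vfield alpha kappa1 kappa2 gamma).

Section VectorFieldLip.
Variable h : (T -> R) -> I -> C.
Hypothesis hl : forall i, cloclip (h^~ i).

Let cloclip_dcoef i : cloclip (fun x => dcoef (h x) i).
Proof. exact: cloclipZ. Qed.

(** Composition with a general [h] serves both uses: [hpart] of the unknown for existence, the
    unknown itself for uniqueness. *)
Lemma cloclip_vfield j : cloclip (fun x => V (h x) j).
Proof.
have conv_lip (g k : (T -> R) -> I -> C) : (forall i, cloclip (g^~ i)) ->
    (forall i, cloclip (k^~ i)) -> cloclip (fun x => conv (g x) (k x) j).
  by move=> gl kl; do 2 (apply: cloclip_sum => ?); apply: cloclipZ; exact: cloclipM.
rewrite /vfield /rhs -mulN1r.
apply: cloclipM; last exact: cloclip_cst.
apply: cloclipD.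
  by apply: cloclipZ; apply: cloclipD; apply: cloclipZ => //; exact: conv_lip.
under eq_fun do rewrite -mulN1r.
do 2 apply: cloclipZ; apply: cloclipD.
  by do 2 apply: cloclipZ; exact: conv_lip.
by apply: conv_lip => // i; exact: cloclipZ.
Qed.

Lemma loclip_ofC_vfield p : loclip (fun x => ofC (V (h x)) p).
Proof. by case: p => i []; have [] := cloclip_vfield i. Qed.

End VectorFieldLip.

(* Projection onto the coefficients of real functions.  The energy identity
   [\sum_j rhs c j * c (rev_ord j) = 0] controls the norm of [c] only there, so global existence
   is obtained for the vector field [V \o hpart] first. *)
Definition hpart c j : C := (c j + (c (rev_ord j))^*) / 2.

Lemma hermitian_hpart c : hermitian (hpart c).
Proof.
move=> j; rewrite /hpart rev_ordK rmorphM/= fmorphV rmorph_nat rmorphD/= conjCK.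
by rewrite addrC.
Qed.

Lemma hpart_id c : hermitian c -> hpart c = c.
Proof.
move=> hc; apply/funext => j.
by rewrite /hpart hc conjCK; field.
Qed.

(** The weight cancels the denominator of the vector field, leaving the real part of the pairing of
    [rhs h] with [c]. Since [rhs h] is Hermitian, that pairing plus its conjugate replaces [c] by
    its Hermitian part [h], where the energy identity applies. *)
Lemma hpart_energy x :
  \sum_p (1 + symb alpha p.1) * x p * ofC (V (hpart (toC x))) p = 0.
Proof.
set c := toC x; set h := hpart c; set r := rhs alpha kappa1 kappa2 gamma h.
have rh : hermitian r by apply: hermitian_rhs; exact: hermitian_hpart.
pose A := \sum_i (c i)^* * r i.
have BE : \sum_i r i * c (rev_ord i) = A^*.
  rewrite (reindex_inj rev_ord_inj)/= rmorph_sum; apply: eq_bigr => i _ /=.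
  by rewrite rev_ordK rh rmorphM/= conjCK mulrC.
have : A + A^* = 0.
  have := energy alpha kappa1 kappa2 gamma h; rewrite -/r -BE => h0.
  transitivity (2 * \sum_i r i * h (rev_ord i)); last by rewrite h0 mulr0.
  rewrite /A -big_split/= mulr_sumr; apply: eq_bigr => i _.
  by rewrite /h /hpart rev_ordK; field.
move=> /(congr1 Re); rewrite ReD Re_conj /= => A0.
have {A0} RA0 : Re A = 0 by lra.
rewrite -[RHS]RA0 /A Re_sum.
transitivity (\sum_i \sum_(b : bool) (1 + symb alpha i) * x (i, b) * ofC (V h) (i, b)).
  by rewrite pair_bigA/=; apply: eq_bigr => -[i b].
apply: eq_bigr => i _; rewrite /r -vfield_rhs big_bool !ofC_true !ofC_false.
move: (V h i) => v; rewrite /c /toC !ReImE /=.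
by ring.
Qed.

(** If [w] solves the projected system, its Hermitian part [c] has derivative [hpart (V c)], which
    is [V c] because the vector field preserves Hermitian symmetry. *)
Lemma real_form_global_solution c0 : hermitian c0 ->
  exists y : T -> R -> R, (forall p, y p 0 = ofC c0 p) /\
    forall p (t : R), 0 <= t -> is_derive t 1 (y p) (ofC (V (toC (y^~ t))) p).
Proof.
move=> h0.
have Fl p : loclip (fun x => ofC (V (hpart (toC x))) p).
  apply: loclip_ofC_vfield => i; under eq_fun do rewrite /hpart mulrC.
  apply: cloclipZ; apply: cloclipD; first exact: cloclip_toC.
  by apply: cloclip_conj; exact: cloclip_toC.
have a1 p : 1 <= 1 + symb alpha p.1 by rewrite lerDl symb_ge0.
have [w [w0 wd]] := global_solution Fl (ofC c0) a1 hpart_energy.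
pose c t := hpart (toC (w^~ t)).
exists (fun p t => ofC (c t) p); split.
  have w00 : w^~ 0 = ofC c0 by apply/funext.
  by move=> p; rewrite /c w00 ofCK hpart_id.
move=> p t t0.
have -> : toC ((fun p t => ofC (c t) p)^~ t) = c t by exact: ofCK.
have Vh : hermitian (V (c t)) by apply: hermitian_vfield; exact: hermitian_hpart.
have halfE (v : C) : v / 2 = (2^-1 : R)%:C * v by rewrite mulrC fmorphV rmorph_nat.
have halfRe (v : C) : Re (v / 2) = 2^-1 * Re v by rewrite halfE ReM /= mul0r subr0.
have halfIm (v : C) : Im (v / 2) = 2^-1 * Im v by rewrite halfE ImM /= mul0r addr0.
(* The sign records the effect of the conjugation in [hpart]: it flips the imaginary coordinate
   only. *)
case: p => j b; pose sg (b : bool) : R := if b then -1 else 1.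
have -> : (fun s => ofC (c s) (j, b)) =
    2^-1 \*: (w (j, b) + sg b \*: w (rev_ord j, b)).
  apply/funext => s; rewrite /c /sg; case: b.
    rewrite ofC_true halfIm ImD Im_conj.
    transitivity (2^-1 * (w (j, true) s + -1 * w (rev_ord j, true) s)); last by [].
    by rewrite /= mulN1r.
  rewrite ofC_false halfRe ReD Re_conj.
  transitivity (2^-1 * (w (j, false) s + 1 * w (rev_ord j, false) s)); last by [].
  by rewrite /= mul1r.
have d1 := wd (j, b) t t0; have d2 := wd (rev_ord j, b) t t0.
apply: is_derive_eq; rewrite /sg /GRing.scale; case: b {d1 d2}.
  by rewrite !ofC_true Vh Im_conj /=; field.
by rewrite !ofC_false Vh Re_conj /=; field.
Qed.

Lemma L2norm_trig_cvg0 (F : set_system R) (FF : Filter F) (e : R -> I -> C) :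
  (forall p, ofC (e s) p @[s --> F] --> (0 : R)) <->
  L2norm (trig z (e s)) @[s --> F] --> (0 : R).
Proof.
have LE s : L2norm (trig z (e s)) = Num.sqrt (2 * pi * \sum_i (Re (e s i) ^+ 2 + Im (e s i) ^+ 2)).
  by apply: L2norm_trig; exact: freq_inj.
split=> h; last first.
  move=> p; apply/cvgrPdist_lt => d d0.
  apply: filterS (cvgr0_norm_lt _ h _ d0) => s; apply: le_lt_trans.
  rewrite sub0r normrN LE [leRHS]ger0_norm ?sqrtr_ge0// -sqrtr_sqr; apply: ler_wsqrtr.
  have term_ge0 i : 0 <= Re (e s i) ^+ 2 + Im (e s i) ^+ 2 by rewrite addr_ge0 ?sqr_ge0.
  apply: (@le_trans _ _ (\sum_i (Re (e s i) ^+ 2 + Im (e s i) ^+ 2))).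
    rewrite (bigD1 p.1)//=; apply: le_trans (_ : _ <= Re (e s p.1) ^+ 2 + Im (e s p.1) ^+ 2) _.
      by rewrite /ofC; case: ifP; rewrite ?lerDl ?lerDr sqr_ge0.
    by rewrite lerDl sumr_ge0.
  rewrite ler_peMl ?sumr_ge0//.
  by have := pi_ge2 R; lra.
under eq_fun do rewrite LE.
have sq p : ofC (e s) p ^+ 2 @[s --> F] --> (0 : R).
  by have := cvg_comp _ _ (h p) (@exprn_continuous R 2 0); rewrite expr0n.
have S0 : \sum_i (Re (e s i) ^+ 2 + Im (e s i) ^+ 2) @[s --> F] --> (0 : R).
  suff : \sum_i (Re (e s i) ^+ 2 + Im (e s i) ^+ 2) @[s --> F] --> \sum_(i : I) (0 + 0 : R).
    by rewrite [X in _ --> X -> _]big1// => i _; rewrite addr0.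
  apply: cvg_big => [|i _]; first exact: add_continuous.
  by apply: cvgD; [exact: (sq (i, false))|exact: (sq (i, true))].
have S1 : 2 * pi * \sum_i (Re (e s i) ^+ 2 + Im (e s i) ^+ 2) @[s --> F] --> (0 : R).
  by have := cvg_comp _ _ S0 (@mulrl_continuous R (2 * pi) 0); rewrite mulr0.
by have := cvg_comp _ _ S1 (@sqrt_continuous R 0); rewrite sqrtr0.
Qed.

End RealForm.

(** * One-sided difference quotients on the half line *)

Section DifferenceQuotients.
Variable R : realType.
Implicit Types (f : R -> R) (t l : R).

Lemma is_derive_quotient f t l : is_derive t 1 f l ->
  (s - t)^-1 * (f s - f t) @[s --> within `[0, +oo[ t^'] --> l.
Proof.
move=> /is_derive1_caratheodory [g [fE gc gt]].
apply/cvgrPdist_lt => e e0.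
have /cvgrPdist_lt/(_ _ e0) := gc; rewrite !near_simpl => ge.
apply: (filterS _ ge) => s; rewrite gt => gs st _.
by rewrite fE mulrCA mulVf ?mulr1// subr_eq0.
Qed.

(** At a positive time the half line is a neighbourhood, so restricting to it loses nothing; the
    slope function completed by [l] at [t] is the Caratheodory witness. *)
Lemma quotient_is_derive f t l : 0 < t ->
  (s - t)^-1 * (f s - f t) @[s --> within `[0, +oo[ t^'] --> l -> is_derive t 1 f l.
Proof.
move=> t0 h; apply/is_derive1_caratheodory.
exists (fun s => if s == t then l else (s - t)^-1 * (f s - f t)); split; last by rewrite eqxx.
  move=> s; case: eqP => [->|/eqP st]; first by rewrite !subrr mulr0.
  by rewrite mulrAC mulVf ?mul1r// subr_eq0.
apply/cvgrPdist_lt => e e0; rewrite eqxx.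
move/cvgrPdist_lt : h => /(_ _ e0) h.
have {}h : nbhs t [set s | s != t -> s \in `[0, +oo[ -> `|l - (s - t)^-1 * (f s - f t)| < e].
  exact: h.
have tpos : nbhs t [set s | 0 < s] by exact: lt_nbhsr.
apply: filterS2 h tpos => s h s0; case: eqP => [_|/eqP st]; first by rewrite subrr normr0.
by apply: h => //; rewrite in_itv/= andbT ltW.
Qed.

(** This includes the endpoint 0, where the one-sided quotient yields no [is_derive]: the increment
    is the quotient times [s - t], which tends to 0. *)
Lemma quotient_continuous f (df : R -> R) :
  (forall t, 0 <= t -> (s - t)^-1 * (f s - f t) @[s --> within `[0, +oo[ t^'] --> df t) ->
  {within `[0, +oo[, continuous f}.
Proof.
move=> h; apply/subspace_continuousP => t; rewrite /= in_itv/= andbT => t0.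
have idc : (s - t) @[s --> within `[0, +oo[ t^'] --> (0 : R).
  rewrite -(subrr t); apply: cvgB; last exact: cvg_cst.
  by move=> P tP; apply: (filterS _ (tP : nbhs t P)) => s Ps _ _.
have : (s - t) * ((s - t)^-1 * (f s - f t)) @[s --> within `[0, +oo[ t^'] --> (0 : R).
  by rewrite -[0 in X in _ --> X](mul0r (df t)); apply: cvgM => //; exact: h.
move=> /cvgrPdist_lt hq; apply/cvgrPdist_lt => e e0.
have {}hq : nbhs t [set s | s != t -> s \in `[0, +oo[ ->
    `|0 - (s - t) * ((s - t)^-1 * (f s - f t))| < e] by exact: hq.
change (nbhs t [set s | s \in `[0, +oo[ -> `|f t - f s| < e]).
apply: (filterS _ hq) => s sP sin.
have [->|st] := eqVneq s t; first by rewrite subrr normr0.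
have := sP st sin; rewrite sub0r normrN mulrA mulfV ?subr_eq0// mul1r.
by rewrite distrC.
Qed.

End DifferenceQuotients.

(** * Translation between Galerkin solutions and the coefficient system *)

Section GalerkinSolutions.
Variables (R : realType) (N : nat) (alpha kappa1 kappa2 gamma : R).
Local Notation C := R[i].
Local Notation I := ('I_(N + N).+1).
Local Notation T := (I * bool)%type.
Local Notation z := (@freq N).
Local Notation V := (@vfield R N alpha kappa1 kappa2 gamma).

Lemma within_cvg (A : set R) (t : R) (g : R -> R) (l : R) :
  g s @[s --> t] --> l -> g s @[s --> within A (nbhs t)] --> l.
Proof. by move=> gl P Pl; apply: (filterS _ (gl P Pl : nbhs t _)) => s Ps _. Qed.

Lemma loclip_ofC_toC_vfield p : loclip (fun x : T -> R => ofC (V (toC x)) p).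
Proof. by apply: loclip_ofC_vfield => i; exact: cloclip_toC. Qed.

Lemma quotient_coef (c : R -> I -> C) (d : I -> C) (t s : R) p :
  ofC (fun i => ((s - t)^-1)%:C * (c s i - c t i) - d i) p =
  (s - t)^-1 * (ofC (c s) p - ofC (c t) p) - ofC d p.
Proof.
by case: p => i []; rewrite ?ofC_true ?ofC_false !ReImE /= ?mul0r ?subr0 ?addr0.
Qed.

Lemma near_cvg (F : set_system R) (FF : Filter F) (g h : R -> R) (l : R) :
  (\forall s \near F, g s = h s) -> g @ F --> l -> h @ F --> l.
Proof.
move=> gh /cvgrPdist_lt gl; apply/cvgrPdist_lt => e e0.
by apply: filterS2 gh (gl e e0) => s ->.
Qed.

Lemma L2norm_cvg0 (F : set_system R) (FF : Filter F) (f : R -> R -> C) (e : R -> I -> C) :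
  (\forall s \near F, f s = trig z (e s)) ->
  (L2norm (f s) @[s --> F] --> (0 : R)) <-> (forall p, ofC (e s) p @[s --> F] --> (0 : R)).
Proof.
move=> fe; split=> [h|/L2norm_trig_cvg0 h].
  apply/L2norm_trig_cvg0; apply: near_cvg h.
  by apply: filterS fe => s ->.
by apply: near_cvg h; apply: filterS fe => s ->.
Qed.

(** Both limits run along the half line, so coefficients at nonnegative times determine them, and by
    Parseval convergence in L2 is coordinatewise. *)
Lemma C1_with_derivativeE (U U' : R -> R -> C) (c c' : R -> I -> C) :
  (forall t, 0 <= t -> U t = trig z (c t)) ->
  (forall t, 0 <= t -> U' t = trig z (c' t)) ->
  C1_with_derivative U U' <-> forall t : R, 0 <= t ->
    (forall p, (s - t)^-1 * (ofC (c s) p - ofC (c t) p)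
        @[s --> within `[0, +oo[ t^'] --> ofC (c' t) p) /\
    (forall p, ofC (c' s) p @[s --> within `[0, +oo[ (nbhs t)] --> ofC (c' t) p).
Proof.
move=> UE U'E.
have quot t : 0 <= t ->
   (L2norm (fun x => ((s - t)^-1)%:C * (U s x - U t x) - U' t x)
       @[s --> within `[0, +oo[ t^'] --> (0 : R)) <->
   (forall p, (s - t)^-1 * (ofC (c s) p - ofC (c t) p)
        @[s --> within `[0, +oo[ t^'] --> ofC (c' t) p).
  move=> t0; rewrite (@L2norm_cvg0 _ _ _
      (fun s i => ((s - t)^-1)%:C * (c s i - c t i) - c' t i)).
    have E p : (fun s => ofC (fun i => ((s - t)^-1)%:C * (c s i - c t i) - c' t i) p) =
        (fun s => (s - t)^-1 * (ofC (c s) p - ofC (c t) p) - ofC (c' t) p).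
      by apply/funext => s; exact: quotient_coef.
    split=> h p; first by apply/subr_cvg0; rewrite -E; exact: h.
    by rewrite E; apply/subr_cvg0; exact: h.
  change (nbhs t [set s | s != t -> s \in `[0, +oo[ ->
    (fun x => ((s - t)^-1)%:C * (U s x - U t x) - U' t x) =
    trig z (fun i => ((s - t)^-1)%:C * (c s i - c t i) - c' t i)]).
  apply: filterE => s _; rewrite in_itv/= andbT => s0; apply/funext => x.
  rewrite !UE// U'E// /trig -sumrB mulr_sumr -sumrB.
  by apply: eq_bigr => i _; ring.
have cont t : 0 <= t ->
   (L2norm (fun x => U' s x - U' t x) @[s --> within `[0, +oo[ (nbhs t)] --> (0 : R)) <->
   (forall p, ofC (c' s) p @[s --> within `[0, +oo[ (nbhs t)] --> ofC (c' t) p).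
  move=> t0; rewrite (@L2norm_cvg0 _ _ _ (fun s i => c' s i - c' t i)).
    have E p : (fun s => ofC (fun i => c' s i - c' t i) p) =
        (fun s => ofC (c' s) p - ofC (c' t) p).
      by apply/funext => s; case: p => i []; rewrite ?ofC_true ?ofC_false !ReImE.
    split=> h p; first by apply/subr_cvg0; rewrite -E; exact: h.
    by rewrite E; apply/subr_cvg0; exact: h.
  change (nbhs t [set s | s \in `[0, +oo[ ->
    (fun x => U' s x - U' t x) = trig z (fun i => c' s i - c' t i)]).
  apply: filterE => s /=; rewrite in_itv/= andbT => s0; apply/funext => x.
  by rewrite !U'E// trigB.
by split=> h t t0; have [h1 h2] := h t t0; split; [apply/quot|apply/cont|apply/quot|apply/cont].
Qed.

(** The coordinates [y] are returned together with their differential equation, which the comparison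
    with another solution uses. *)
Lemma galerkin_existence u0 : (forall x : R, complex.Im (u0 x) = 0) ->
  exists y : T -> R -> R,
   [/\ galerkin_solution alpha kappa1 kappa2 gamma N u0 (fun t => trig z (toC (y^~ t))),
      forall p, y p 0 = ofC (fun i => fourier u0 (freq i)) p &
      forall p (t : R), 0 <= t -> is_derive t 1 (y p) (ofC (V (toC (y^~ t))) p)].
Proof.
move=> u0R.
have h0 : hermitian (fun i : I => fourier u0 (freq i)).
  by move=> i; rewrite freq_rev fourier_conj.
have [y [y0 yd]] := real_form_global_solution alpha kappa1 kappa2 gamma h0.
exists y; split => //; split.
- by move=> t t0; apply/VNP; exists (toC (y^~ t)).
- move=> x; rewrite PNE; congr (trig _ _ x).
  have -> : y^~ 0 = ofC (fun i => fourier u0 (freq i)) by apply/funext.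
  by rewrite ofCK.
exists (fun t => trig z (V (toC (y^~ t)))); split.
- by move=> t t0; apply/VNP; exists (V (toC (y^~ t))).
- apply/(@C1_with_derivativeE _ _ (fun t => toC (y^~ t)) (fun t => V (toC (y^~ t)))) => //.
  move=> t t0; split=> p.
    under eq_fun do rewrite !toCK.
    exact: is_derive_quotient (yd p t t0).
  apply: within_cvg; apply: (loclip_continuous _ (loclip_ofC_toC_vfield p)) => q.
  by apply: differentiable_continuous; apply/derivable1_diffP; have [] := yd q t t0.
- move=> t phi t0 /VNP[b bE]; have -> : phi = trig z b by exact/funext.
  exact: galerkin_vfield.
Qed.

(** The coefficients are read off as Fourier coefficients, and testing against all of [VN]
    identifies their derivative with the vector field. Nothing is claimed about Hermitian symmetry
    of [c]. *)
Lemma galerkin_solution_coef u0 (W : R -> R -> C) :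
  galerkin_solution alpha kappa1 kappa2 gamma N u0 W ->
  exists c : R -> I -> C,
   [/\ forall t, 0 <= t -> W t = trig z (c t),
      forall i, c 0 i = fourier u0 (freq i),
      forall p, {within `[0, +oo[, continuous (fun t => ofC (c t) p)} &
      forall p (t : R), 0 < t -> is_derive t 1 (fun t => ofC (c t) p) (ofC (V (c t)) p)].
Proof.
move=> [WV W0 [W' [W'V WC1 Wid]]].
have coef (Z : R -> R -> C) : (forall t : R, 0 <= t -> VN N (Z t)) ->
    forall t : R, 0 <= t -> Z t = trig z (fun i => fourier (Z t) (freq i)).
  move=> ZV t t0; have [a aE] := (VNP _ _).1 (ZV t t0).
  have -> : Z t = trig z a by exact/funext.
  congr trig; apply/funext => i; rewrite fourier_trig_inj//; exact: freq_inj.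
pose c t i := fourier (W t) (@freq N i); pose c' t i := fourier (W' t) (@freq N i).
have Wc := coef W WV; have W'c := coef W' W'V.
have c'E (t : R) : 0 <= t -> c' t = V (c t).
  move=> t0; apply/funext; apply: galerkin_vfield_unique => b.
  rewrite -Wc// -W'c//; apply: Wid => //.
  by apply/VNP; exists b.
have quot (t : R) p : 0 <= t -> (s - t)^-1 * (ofC (c s) p - ofC (c t) p)
    @[s --> within `[0, +oo[ t^'] --> ofC (c' t) p.
  by move=> t0; exact: ((C1_with_derivativeE Wc W'c).1 WC1 t t0).1.
exists c; split => //.
- move=> i; rewrite /c (_ : W 0 = PN N u0); last exact/funext.
  by rewrite PNE fourier_trig_inj//; exact: freq_inj.
- by move=> p; apply: (@quotient_continuous _ _ (fun t => ofC (c' t) p)) => t t0; exact: quot.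
- move=> p t t0; apply: quotient_is_derive => //; rewrite -c'E ?ltW//.
  by apply: quot; exact: ltW.
Qed.

End GalerkinSolutions.

Theorem mainTheorem5 (R : realType) (alpha kappa1 kappa2 gamma : R) (N : nat)
    (u0 : R -> complex R)
    (halpha : 1 <= alpha <= 2) (hgamma : 0 < gamma)
    (hu0 : L2per u0) (hu0_real : forall x : R, complex.Im (u0 x) = 0) :
  exists U : R -> R -> complex R,
    galerkin_solution alpha kappa1 kappa2 gamma N u0 U /\
    forall W : R -> R -> complex R,
      galerkin_solution alpha kappa1 kappa2 gamma N u0 W ->
      forall t x : R, 0 <= t -> W t x = U t x.
Proof.
have [y [Usol y0 yd]] := galerkin_existence N alpha kappa1 kappa2 gamma hu0_real.
exists (fun t => trig (@freq N) (toC (y^~ t))); split => // W Wsol t x t0.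
have [c [WE c0 cc cd]] := galerkin_solution_coef Wsol.
rewrite WE//; congr (trig _ _ x); apply/funext => i.
have Fl (p : 'I_(N + N).+1 * bool) := loclip_ofC_toC_vfield alpha kappa1 kappa2 gamma p.
have yc p : {within `[0, +oo[, continuous (y p)}.
  apply: derivable_within_continuous => s; rewrite in_itv/= andbT => s0.
  by have [] := yd p s s0.
have cd' p (s : R) : 0 < s -> is_derive s 1 (fun t => ofC (c t) p)
    (ofC (vfield alpha kappa1 kappa2 gamma (toC (fun q => ofC (c s) q))) p).
  by move=> s0; rewrite (ofCK (c s)); exact: cd.
have yd' p (s : R) : 0 < s -> is_derive s 1 (y p)
    (ofC (vfield alpha kappa1 kappa2 gamma (toC (y^~ s))) p).
  by move=> /ltW; exact: yd.
have c0y p : ofC (c 0) p = y p 0.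
  by rewrite y0; congr (ofC _ p); apply/funext => j; exact: c0.
have cy := @loclip_uniqueness R _ _ Fl (fun p t => ofC (c t) p) y cc yc cd' yd' c0y.
rewrite -(ofCK (c t)); congr (toC _ i); apply/funext => p; exact: (cy p t t0).
Qed.
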